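(* Let $T(n)$ denote the time required to compute the $(\min,+)$ convolution of two arrays of length $n$. Then All-Target Unbounded Knapsack can be solved in $O(T(u)\log^3(u)+t\log^2(u))$ time.
   Context: All-Target Unbounded Knapsack: the input consists of positive integers $n,u,t$, integer weights $w_1,\dots,w_n\in[1,u]$ and integer profits $p_1,\dots,p_n\in\mathbb{Z}$. A solution to a sum $c$ is a vector $(m_1,\dots,m_n)\in\mathbb{N}^n$ with $c=\sum_{i=1}^n w_im_i$; its value is $\sum_{i=1}^n p_im_i$. For each integer $c\in[1,t]$ the output is the maximum value of a solution to sum $c$, or $-\infty$ if no solution to $c$ exists. The $(\min,+)$ convolution of arrays $a[0..n]$ and $b[0..m]$ is the array $c[0..n+m]$ with $c[i]=\min_{j+k=i}(a[j]+b[k])$.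
   Formalization: The time bound has an extra summand max(n−u, 0), needed to read the input when more than u items (repeated weights) are given and zero for n ≤ u; log(u) is read as 1 at u = 1, where the literal bound would be time 0. *)

(* Defs.v *)
From mathcomp Require Import all_boot all_order all_algebra.

Set Implicit Arguments.
Unset Strict Implicit.
Unset Printing Implicit Defensive.

Import Order.TTheory GRing.Theory Num.Theory.

(* A deterministic word RAM, presented as structured programs.  A state has
   registers and memory banks ("arrays"), with each program naming only finitely
   many of each; banks can be interleaved into one memory at constant overhead.
   Memory cells are addressed by the nonnegative contents of a register. *)
Record state := State { reg : nat -> int; cell : nat -> nat -> int }.

Definition set_reg (s : state) (r : nat) (v : int) : state :=
  State (fun r' => if r' == r then v else reg s r') (cell s).

Definition set_cell (s : state) (b i : nat) (v : int) : state :=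
  State (reg s)
    (fun b' i' => if (b' == b) && (i' == i) then v else cell s b' i').

Inductive binop := OAdd | OSub | OMul | ODiv | OAnd | OOr | OXor | OShl | OShr.

(* Division rounds as in intdiv; bitwise operations act on magnitudes. *)
Definition eval_op (o : binop) (x y : int) : int :=
  match o with
  | OAdd => (x + y)%R
  | OSub => (x - y)%R
  | OMul => (x * y)%R
  | ODiv => (x %/ y)%Z
  | OAnd => Posz (Nat.land `|x|%N `|y|%N)
  | OOr  => Posz (Nat.lor  `|x|%N `|y|%N)
  | OXor => Posz (Nat.lxor `|x|%N `|y|%N)
  | OShl => (x * (2 ^ `|y|)%:Z)%R
  | OShr => (x %/ (2 ^ `|y|)%:Z)%Z
  end.

Inductive test := TLt (x y : nat) | TLe (x y : nat) | TEq (x y : nat).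

Definition eval_test (t : test) (s : state) : bool :=
  match t with
  | TLt x y => (reg s x < reg s y)%R
  | TLe x y => (reg s x <= reg s y)%R
  | TEq x y => reg s x == reg s y
  end.

Inductive cmd :=
  | Skip
  | Const (r : nat) (v : int)          (* r := v *)
  | Op (o : binop) (r x y : nat)       (* r := x o y *)
  | Read (r b x : nat)                 (* r := b[x] *)
  | Write (b x r : nat)                (* b[x] := r *)
  | Seq (c1 c2 : cmd)
  | If (t : test) (c1 c2 : cmd)
  | While (t : test) (c : cmd).

(* [exec W c s k s']: from [s], the program [c] halts in [s'] after exactly [k]
   unit-cost steps, on a machine whose words are the integers of magnitude at
   most [W].  A program that would produce any other integer, or that uses a
   negative address, is stuck. *)
Inductive exec (W : nat) : cmd -> state -> nat -> state -> Prop :=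
  | ExecSkip s : exec W Skip s 1 s
  | ExecConst r v s :
      `|v|%N <= W -> exec W (Const r v) s 1 (set_reg s r v)
  | ExecOp o r x y s :
      `|eval_op o (reg s x) (reg s y)|%N <= W ->
      exec W (Op o r x y) s 1 (set_reg s r (eval_op o (reg s x) (reg s y)))
  | ExecRead r b x i s :
      reg s x = Posz i -> `|cell s b i|%N <= W ->
      exec W (Read r b x) s 1 (set_reg s r (cell s b i))
  | ExecWrite b x r i s :
      reg s x = Posz i -> exec W (Write b x r) s 1 (set_cell s b i (reg s r))
  | ExecSeq c1 c2 s1 s2 s3 k1 k2 :
      exec W c1 s1 k1 s2 -> exec W c2 s2 k2 s3 ->
      exec W (Seq c1 c2) s1 (k1 + k2) s3
  | ExecIfTrue t c1 c2 s s' k :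
      eval_test t s -> exec W c1 s k s' -> exec W (If t c1 c2) s k.+1 s'
  | ExecIfFalse t c1 c2 s s' k :
      ~~ eval_test t s -> exec W c2 s k s' -> exec W (If t c1 c2) s k.+1 s'
  | ExecWhileFalse t c s :
      ~~ eval_test t s -> exec W (While t c) s 1 s
  | ExecWhileTrue t c s1 s2 s3 k1 k2 :
      eval_test t s1 -> exec W c s1 k1 s2 -> exec W (While t c) s2 k2 s3 ->
      exec W (While t c) s1 (k1 + k2).+1 s3.

Definition fits (W : nat) (s : state) : Prop :=
  (forall r, `|reg s r|%N <= W) /\ (forall b i, `|cell s b i|%N <= W).

Record problem := Problem {
  instance : Type;
  valid : instance -> Prop;
  (* The word length must be a large enough constant times log (magnitude x). *)
  magnitude : instance -> nat;
  encodes : instance -> state -> Prop;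
  answers : instance -> state -> Prop
}.

(* Some program answers every valid instance [x] within [time x] steps, on every
   machine with [W >= magnitude x ^ e] for a constant [e] depending only on the
   program.  Registers and cells that do not hold the input start with
   arbitrary words. *)
Definition solvable_in (pb : problem) (time : instance pb -> nat) : Prop :=
  exists (c : cmd) (e : nat),
    forall (x : instance pb) (W : nat) (s : state),
      valid x -> magnitude x ^ e <= W -> fits W s -> encodes x s ->
      exists (k : nat) (s' : state),
        [/\ exec W c s k s', k <= time x & answers x s'].

(* (min,+) convolution of arrays of lengths [n] and [m]. *)
Definition is_minplus_conv (n m : nat) (a : 'I_n -> int) (b : 'I_m -> int)
    (c : 'I_(n + m).-1 -> int) : Prop :=
  forall i : 'I_(n + m).-1,
    (exists (j : 'I_n) (k : 'I_m), j + k = i /\ c i = (a j + b k)%R) /\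
    (forall (j : 'I_n) (k : 'I_m), j + k = i -> (c i <= a j + b k)%R).

Record conv_instance := ConvInstance {
  conv_len : nat;
  conv_a : 'I_conv_len -> int;
  conv_b : 'I_conv_len -> int
}.

(* Input: length in register 0, arrays in banks 0 and 1.  Output: bank 2. *)
Definition minplus_convolution : problem := {|
  instance := conv_instance;
  valid x := 0 < conv_len x;
  magnitude x := (conv_len x + \max_(i < conv_len x) `|conv_a i|%N
                  + \max_(i < conv_len x) `|conv_b i|%N + 2)%N;
  encodes x s :=
    [/\ reg s 0 = Posz (conv_len x),
        forall i : 'I_(conv_len x), cell s 0 i = conv_a i
      & forall i : 'I_(conv_len x), cell s 1 i = conv_b i];
  answers x s :=
    is_minplus_conv (@conv_a x) (@conv_b x) (fun i => cell s 2 i)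
|}.

Record knapsack_instance := KnapsackInstance {
  items : nat;
  max_weight : nat;
  target : nat;
  weight : 'I_items -> nat;
  profit : 'I_items -> int
}.

Definition is_solution (x : knapsack_instance) (c : nat)
    (m : 'I_(items x) -> nat) : Prop :=
  c = \sum_(i < items x) weight i * m i.

Definition value (x : knapsack_instance) (m : 'I_(items x) -> nat) : int :=
  (\sum_(i < items x) profit i * (m i)%:Z)%R.

(* [None] stands for minus infinity. *)
Definition is_opt (x : knapsack_instance) (c : nat) (o : option int) : Prop :=
  match o with
  | Some v =>
      (exists m : 'I_(items x) -> nat, is_solution c m /\ value m = v) /\
      (forall m : 'I_(items x) -> nat, is_solution c m -> (value m <= v)%R)
  | None => ~ exists m : 'I_(items x) -> nat, is_solution c m
  end.

(* Input: n, u, t in registers 0, 1, 2, weights in bank 0, profits in bank 1.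
   Output: entry [c] is minus infinity if cell [c] of bank 3 is 0, and otherwise
   the content of cell [c] of bank 2. *)
Definition all_target_unbounded_knapsack : problem := {|
  instance := knapsack_instance;
  valid x := [/\ 0 < items x, 0 < max_weight x, 0 < target x
    & forall i : 'I_(items x), 1 <= weight i <= max_weight x];
  magnitude x := (items x + max_weight x + target x
                  + \max_(i < items x) `|profit i|%N + 2)%N;
  encodes x s :=
    [/\ [/\ reg s 0 = Posz (items x), reg s 1 = Posz (max_weight x)
          & reg s 2 = Posz (target x)],
        forall i : 'I_(items x), cell s 0 i = Posz (weight i)
      & forall i : 'I_(items x), cell s 1 i = profit i];
  answers x s :=
    forall c : nat, 1 <= c <= target x ->
      is_opt x c (if cell s 3 c == 0%R then None else Some (cell s 2 c))
|}.

(* Binary logarithm inside O(-), read as 1 at u = 1. *)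
Definition lg (u : nat) : nat := maxn 1 (trunc_log 2 u).

(* Main.v *)
Require Import Defs.
From mathcomp Require Import all_boot all_order all_algebra.
From mathcomp Require Import zify.
From Stdlib Require Import Classical.

(* Negate the profits into costs and scale these by [u + 1].  Among the optimal
   multisets of weights with a given sum, single out the canonical one, obtained
   by always taking the smallest weight that occurs in some optimal multiset.
   Sub-multisets of canonical multisets are canonical, and a canonical multiset
   is determined by its sum; hence the [s] distinct weights of a canonical
   multiset have [2 ^ s] distinct subset sums, all at most [s * u], and
   [s = O(log u)].  For some [N = O(log u)], a canonical multiset of sum at least
   [N * u] therefore repeats a weight [w], and without one copy of [w] it is
   still canonical and still contains [w].  So beyond [N * u] all optima are
   found by pushing from each target along the weights of its canonical
   multiset only, which costs [O(t * log u)].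
   The targets below [N * u] are handled by [N] squarings under the (min,+)
   product, each made of [N ^ 2] convolutions of length [u].  One more product,
   with the costs [(u + 1) * cost w + w], leaves the smallest first weight of an
   optimal multiset in the residue modulo [u + 1]; the canonical multisets are
   then stored as linked lists through their first weights. *)

Set Implicit Arguments.
Unset Strict Implicit.
Unset Printing Implicit Defensive.
Import Order.TTheory GRing.Theory Num.Theory.

(** * Canonical optimal multisets *)

Lemma ex_least_nat (P : nat -> Prop) :
  (exists n, P n) -> exists n, P n /\ forall m, P m -> n <= m.
Proof.
case=> n; elim/ltn_ind: n => n IH Pn.
case: (classic (exists2 m, m < n & P m)) => [[m /IH]|H]; first exact.
exists n; split=> // m Pm; rewrite leqNgt; apply/negP => lt_mn.
by apply: H; exists m.
Qed.

Section Canonical.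

Variables (u : nat) (av : pred nat) (q : nat -> int).
Hypothesis av_range : forall w, av w -> 0 < w <= u.

Definition cost (l : seq nat) : int := (\sum_(w <- l) q w)%R.

Lemma cost_nil : cost [::] = 0%R.
Proof. exact: big_nil. Qed.

Lemma cost_cons w l : cost (w :: l) = (q w + cost l)%R.
Proof. exact: big_cons. Qed.

Lemma cost_cat l1 l2 : cost (l1 ++ l2) = (cost l1 + cost l2)%R.
Proof. exact: big_cat. Qed.

Lemma perm_cost l1 l2 : perm_eq l1 l2 -> cost l1 = cost l2.
Proof. exact: perm_big. Qed.

Lemma perm_sumn l1 l2 : perm_eq l1 l2 -> sumn l1 = sumn l2.
Proof. by move=> e; rewrite !sumnE; apply: perm_big. Qed.

Lemma size_le_sumn l : all av l -> size l <= sumn l.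
Proof.
by elim: l => //= w l IH /andP[/av_range/andP[w0 _] /IH]; lia.
Qed.

Lemma sumn_le_size l : all av l -> sumn l <= size l * u.
Proof.
elim: l => //= w l IH /andP[/av_range/andP[_ wu] /IH].
by rewrite mulSn; apply: leq_add.
Qed.

Lemma cost_bound (pm : nat) l : (forall w, av w -> `|q w|%N <= pm) ->
  all av l -> `|cost l|%N <= pm * sumn l.
Proof.
move=> hq; elim: l => [|w l IH] /=; first by rewrite cost_nil.
move=> /andP[avw /IH]; rewrite cost_cons mulnDr.
have /andP[w0 _] := av_range avw; have := hq _ avw.
have : pm <= pm * w by rewrite leq_pmulr.
lia.
Qed.

Definition opt (l : seq nat) : Prop := all av l /\
  forall l', all av l' -> sumn l' = sumn l -> (cost l <= cost l')%R.

(* The optimal multiset with the smallest weight first, and so on: it is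
   listed in nondecreasing order and determined by its sum. *)
Fixpoint canon (l : seq nat) : Prop :=
  if l is w :: l0 then
    [/\ opt l, forall l', opt l' -> sumn l' = sumn l -> {in l', forall v, w <= v}
      & canon l0]
  else True.

Lemma opt_nil : opt [::].
Proof.
split=> // -[|w l] //= /andP[/av_range]; lia.
Qed.

Lemma canon_opt l : canon l -> opt l.
Proof. by case: l => [|w l] /=; [move=> _; exact: opt_nil | case]. Qed.

Lemma canon_all l : canon l -> all av l.
Proof. by move/canon_opt; case. Qed.

(** Costs may be negative, but weights are positive, so a list of given sum has bounded length and
    its cost is bounded below. Adding [B * sumn l] turns the costs into natural numbers, among which
    there is a least one. *)
Lemma ex_opt l : all av l -> exists2 l', opt l' & sumn l' = sumn l.
Proof.
move=> avl.
pose B := \sum_(w < u.+1) `|q w|%N.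
have hq w : av w -> `|q w|%N <= B.
  move=> /av_range wu; have wlt : w < u.+1 by lia.
  by rewrite /B (bigD1 (Ordinal wlt)) //= leq_addr.
pose P n := exists l', [/\ all av l', sumn l' = sumn l &
  (cost l' + (B * sumn l)%:Z)%R = Posz n].
have Pex l' : all av l' -> sumn l' = sumn l -> P `|(cost l' + (B * sumn l)%:Z)%R|%N.
  move=> a e; exists l'; split=> //.
  have := cost_bound hq a; rewrite e; lia.
have [|n [[l' [a e c]] Hn]] := @ex_least_nat P.
  by eexists; apply: (Pex l avl).
exists l' => //; split=> // l2 a2 e2.
have e2' : sumn l2 = sumn l by rewrite e2.
have := Hn _ (Pex _ a2 e2'); have := cost_bound hq a2.
rewrite e2'; lia.
Qed.

Lemma opt_perm l1 l2 : perm_eq l1 l2 -> opt l1 -> opt l2.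
Proof.
move=> e [a h]; split; first by rewrite -(perm_all _ e).
by move=> l' a' s'; rewrite -(perm_cost e); apply: h => //; rewrite (perm_sumn e).
Qed.

Lemma opt_catl l1 l2 : opt (l1 ++ l2) -> opt l1.
Proof.
rewrite /opt all_cat => -[/andP[a1 a2] h]; split=> // l' a' s'.
have := h (l' ++ l2); rewrite all_cat a' a2 !sumn_cat s' !cost_cat => /(_ isT erefl).
lia.
Qed.

(** Both [l1] (as a part of an optimal list) and [l1'] are optimal for the same sum, so they cost
    the same and the exchange leaves the total cost unchanged. *)
Lemma opt_swap l1 l1' l2 : opt (l1 ++ l2) -> opt l1' -> sumn l1' = sumn l1 ->
  opt (l1' ++ l2).
Proof.
move=> o o1 e; have [a1 h1] := o1.
have o1' := opt_catl o; case: o => a h.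
move: a; rewrite all_cat => /andP[a1' a2].
split; first by rewrite all_cat a1.
move=> l' a' s'; have := h l' a'; rewrite s' !sumn_cat e => /(_ erefl).
rewrite !cost_cat; have := h1 _ a1' (esym e); lia.
Qed.

Lemma subseq_perm (s l : seq nat) : subseq s l -> exists r, perm_eq l (s ++ r).
Proof.
elim: l s => [|v l IH] [|w s] //=.
- by exists [::].
- by exists (v :: l).
case: eqP => [->|_] /IH[r e].
  by exists r; rewrite /= perm_cons.
exists (v :: r); apply: (@perm_trans _ ([:: v] ++ (w :: s) ++ r)).
  by rewrite /= perm_cons.
by rewrite -(cat1s v r) perm_catCA.
Qed.

Lemma opt_subseq s l : subseq s l -> opt l -> opt s.
Proof. by case/subseq_perm => r e /(opt_perm e)/opt_catl. Qed.

(** Exchange argument: an optimal competitor of the sub-multiset [v :: s], completed by the left-out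
    entries [r], is an optimal competitor of the whole list. The minimality of [v] there bounds all
    weights of the competitor. *)
Lemma canon_subseq s l : subseq s l -> canon l -> canon s.
Proof.
elim: l s => [|v l IH] [|w s] //= sub [o m c].
move: (sub); case: eqP => [ewv sub'|_ sub']; last exact: (IH _ sub' c).
subst w; split; [|  | exact: IH sub' c].
  by apply: opt_subseq o; rewrite /= eqxx.
move=> l' o' s' x xl'.
have [r e] := subseq_perm sub'.
have e' : perm_eq (v :: l) ((v :: s) ++ r) by rewrite /= perm_cons.
apply: (m (l' ++ r)); last by rewrite mem_cat xl'.
  by apply: (@opt_swap (v :: s)) => //; apply: opt_perm o.
by rewrite -[RHS]/(sumn (v :: l)) (perm_sumn e') !sumn_cat s'.
Qed.

(** Each head is at most every weight of any optimal list of the common sum, in particular at most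
    the other head. So the heads agree, and the tails have equal sums. *)
Lemma canon_unique l l' : canon l -> canon l' -> sumn l = sumn l' -> l = l'.
Proof.
elim: l l' => [|v l IH] [|w l'] //=.
- by move=> _ [[/= /andP[/av_range]]]; lia.
- by move=> [[/= /andP[/av_range]]]; lia.
move=> [o m c] [o' m' c'] e.
have ev : v = w.
  apply/eqP; rewrite eqn_leq (m _ o') ?(m' _ o) //= ?inE ?eqxx //.
by rewrite ev in e *; congr (_ :: _); apply: IH => //; lia.
Qed.

(** Take the smallest weight [w] that occurs in any optimal list of this sum, and replace what is
    left of such a list by a canonical list. By [opt_swap] the result is still optimal. *)
Lemma ex_canon l : all av l -> exists2 l', canon l' & sumn l' = sumn l.
Proof.
have [n] := ubnP (sumn l); elim: n l => // n IH l ltn a.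
have [z|nz] := eqVneq (sumn l) 0; first by exists [::].
pose P w := exists2 l', opt l' & sumn l' = sumn l /\ w \in l'.
have [|w [[l' o' [s' wl']] m]] := @ex_least_nat P.
  have [l' o' s'] := ex_opt a.
  case: l' o' s' => [|w l'] o' s'; first by rewrite -s' in nz.
  by exists w, (w :: l') => //; rewrite inE eqxx.
have e := perm_to_rem wl'.
have o2 := opt_perm e o'.
have s2 := perm_sumn e.
have w0 : 0 < w by have := allP (o'.1) _ wl' => /av_range; lia.
have [||l2 c2 s3] := IH (rem w l').
- by move: s2 => /=; lia.
- by case: o2 => /= /andP[].
have sl2 : sumn (w :: l2) = sumn l by rewrite -s' s2 /= s3.
exists (w :: l2) => //=; split=> //.
  have e3 : perm_eq (w :: rem w l') (rem w l' ++ [:: w]).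
    by rewrite -cat1s perm_catC.
  apply: (@opt_perm (l2 ++ [:: w])); first by rewrite perm_catC.
  by apply: (@opt_swap (rem w l')) (canon_opt c2) s3; apply: opt_perm e3 o2.
move=> l'' o'' s'' v vl''; apply: m; exists l'' => //; split=> //.
by rewrite s''.
Qed.

Lemma canon_head_le w l : canon (w :: l) -> {in l, forall v, w <= v}.
Proof. by case=> o m _ v vl; apply: (m (w :: l)) => //; rewrite inE vl orbT. Qed.

Lemma mask_inj (T : eqType) (s : seq T) (m1 m2 : bitseq) : uniq s ->
  size m1 = size s -> size m2 = size s -> mask m1 s = mask m2 s -> m1 = m2.
Proof.
elim: s m1 m2 => [|x s IH] [|b1 m1] [|b2 m2] //= /andP[xs us] [s1] [s2] e.
have nin m : x \notin mask m s.
  by apply: contra xs => /mem_mask.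
case: b1 b2 e => [] [] /=.
- by move=> [/(IH _ _ us s1 s2) ->].
- by move=> e; have := nin m2; rewrite -e inE eqxx.
- by move=> e; have := nin m1; rewrite e inE eqxx.
- by move=> /(IH _ _ us s1 s2) ->.
Qed.

(* Equal sums of sub-multisets of a canonical list force equal lists, so the
   [2 ^ s] subset sums of its support are pairwise distinct. *)
Lemma canon_support l : canon l ->
  2 ^ size (undup l) <= (size (undup l) * u).+1.
Proof.
move=> cl; set s := undup l.
have cs m : canon (mask m s).
  by apply: canon_subseq cl; apply: subseq_trans (mask_subseq _ _) (undup_subseq _).
have avs : all av s by rewrite all_undup canon_all.
have bnd (m : (size s).-tuple bool) : sumn (mask m s) < (size s * u).+1.
  rewrite ltnS; apply: leq_trans (sumn_le_size _) _.
    exact: canon_all (cs m).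
  by rewrite leq_mul2r size_subseq ?orbT // mask_subseq.
pose f m := Ordinal (bnd m).
have finj : injective f.
  move=> m1 m2 /(congr1 val) /= e.
  apply/val_inj/(@mask_inj _ s); rewrite ?undup_uniq ?size_tuple //.
  exact: canon_unique.
have := leq_card f finj.
by rewrite card_tuple card_bool card_ord.
Qed.

(** Let [s] be the support size. From [2 ^ s <= s * 2 ^ J] and [s * s <= 2 ^ s], valid from 4 on,
    follows [s <= 2 ^ J], hence [2 ^ s <= 2 ^ J * 2 ^ J]. This is incompatible with
    [s >= J.*2 + 4]. *)
Lemma canon_support_lt J l : u < 2 ^ J -> canon l ->
  size (undup l) < J.*2 + 4.
Proof.
move=> uJ /canon_support; set s := size _ => h.
rewrite ltnNge; apply/negP => hs.
have s0 : 0 < s by lia.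
have h1 : 2 ^ s <= s * 2 ^ J.
  apply: leq_trans h _; apply: (@leq_trans (s * u.+1));
    last by rewrite leq_mul2l uJ orbT.
  by rewrite mulnS; lia.
have h3 k : (4 + k) * (4 + k) <= 2 ^ (4 + k).
  by elim: k => // k IH; rewrite addnS expnS; lia.
have := h3 (s - 4); rewrite subnKC; last lia.
move=> ss; have sJ : s <= 2 ^ J by rewrite -(leq_pmul2l s0) (leq_trans ss).
have hJ : 2 ^ (J.*2 + 4) <= 2 ^ s by rewrite leq_exp2l.
have e : 2 ^ (J.*2 + 4) = 16 * (2 ^ J * 2 ^ J).
  by rewrite expnD -addnn expnD mulnC.
have P0 : 0 < 2 ^ J by rewrite expn_gt0.
have : s * 2 ^ J <= 2 ^ J * 2 ^ J by rewrite leq_mul2r sJ orbT.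
have : 0 < 2 ^ J * 2 ^ J by rewrite muln_gt0 P0.
lia.
Qed.

(** Without a repetition the length of the list is its support size, which is below [J.*2 + 4], and
    each entry is at most [u]. *)
Lemma canon_repeat J l : 0 < u < 2 ^ J -> canon l -> (J.*2 + 4) * u <= sumn l ->
  exists2 w, w \in l & w \in rem w l.
Proof.
move=> /andP[u0 uJ] cl big.
have [U|/negP nU] := boolP (uniq l).
  have := canon_support_lt uJ cl; rewrite undup_id // -(ltn_pmul2r u0).
  by rewrite ltnNge (leq_trans big) // sumn_le_size ?canon_all.
have [w wl] : exists2 w, w \in l & 1 < count_mem w l.
  apply: NNPP => H; apply: nU; apply: count_mem_uniq => x.
  have [xl|xl] := boolP (x \in l); last by rewrite (count_memPn xl).
  have : 0 < count_mem x l by rewrite -has_count has_pred1.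
  case: (ltngtP (count_mem x l) 1) ; [lia | by move=> c1; case: H; exists x | by []].
rewrite (permP (perm_to_rem wl)) /= eqxx => c1; exists w => //.
by rewrite -has_pred1 has_count; apply: c1.
Qed.

Definition others (l : seq nat) := [seq w <- l | w != head 0 l].

Lemma others_subseq l : subseq (others l) l.
Proof. exact: filter_subseq. Qed.

Lemma mem_others l w : w \in l -> w = head 0 l \/ w \in others l.
Proof. by move=> wl; rewrite mem_filter wl andbT; case: eqP; [left | right]. Qed.

Lemma size_undup_others w l :
  (size (undup (others (w :: l)))).+1 = size (undup (w :: l)).
Proof.
rewrite -filter_undup -rem_filter ?undup_uniq // size_rem ?mem_undup ?inE ?eqxx //.
by rewrite prednK //= lt0n size_eq0; case: ifP => // wl; apply: contraTneq wl => e;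
  rewrite -mem_undup e.
Qed.

(** A canonical list is nondecreasing, so copies of [w] are adjacent: if [l] does not start with
    [w], it does not contain it. Hence the link of a list is either copied from that of its tail or
    points to the tail itself. *)
Lemma others_cons w l : canon (w :: l) ->
  others (w :: l) = if head 0 l == w then others l else l.
Proof.
move=> c; have cl : canon l by case: c.
rewrite /others /= eqxx /=; case: eqP => [-> //|ne].
apply/all_filterP/allP => x xl; case: l c cl ne xl => // v l c cl /= /eqP ne xl.
have wv : w <= v by apply: canon_head_le c _ _; rewrite inE eqxx.
have vx : v <= x by move: xl; rewrite inE => /orP[/eqP -> //|];
  apply: canon_head_le cl _.
by apply: contraNneq ne => e; rewrite eqn_leq wv andbT -e.
Qed.

(** * Values that record the cost together with a first weight *)

Variable S : nat.
Hypothesis uS : u < S.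

(* The list [::] gets value 0; any other list records its first weight modulo
   [S], so that smaller values mean smaller cost, then smaller first weight. *)
Definition gval (l : seq nat) : int := (S%:Z * cost l + (head 0%N l)%:Z)%R.

Lemma gvalE l : gval l = (S%:Z * cost l + (head 0%N l)%:Z)%R.
Proof. by []. Qed.

(** The recorded weight [x] may be any member of the list. Intermediate table entries satisfy only
    this; their minimum is then [gval] of the canonical list. *)
Definition attained (v : int) (c : nat) : Prop := exists (l : seq nat) (x : nat),
  [/\ all av l, sumn l = c, x \in l & v = (S%:Z * cost l + x%:Z)%R].

Lemma attained_gval l : canon l -> 0 < sumn l -> attained (gval l) (sumn l).
Proof.
case: l => // w l c _; exists (w :: l), w; split=> //; first exact: canon_all.
by rewrite inE eqxx.
Qed.

(** If the costs agree, the competitor is optimal and canonicity gives [head 0 l <= x]. Otherwise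
    the scaled costs differ by at least [S], which exceeds every head. *)
Lemma gval_min v l : canon l -> attained v (sumn l) -> (gval l <= v)%R.
Proof.
move=> cl [l' [x [a' s' xl' ->]]]; have [al hl] := canon_opt cl.
have := hl _ a' s'; rewrite le_eqVlt => /orP[/eqP e|lt].
  rewrite /gval e lerD2l lez_nat; case: l cl {al} s' e hl => // w l [o m c] s' e hl.
  apply: (m l') => //; split=> // l2 a2 s2; rewrite -e; apply: hl => //.
  by rewrite s2.
have hd : head 0 l < S.
  apply: leq_ltn_trans uS.
  by case: l al {cl hl s' lt} => // w l /andP[/av_range/andP[]].
have : (S%:Z * (cost l + 1) <= S%:Z * cost l')%R.
  by apply: ler_wpM2l => //; lia.
rewrite mulrDr mulr1 /gval; lia.
Qed.

Lemma attained_push l w : canon l -> w \in l ->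
  attained (gval l + S%:Z * q w)%R (sumn l + w).
Proof.
move=> c wl; exists (w :: l), (head 0 l); split=> /=.
- by rewrite (allP (canon_all c)) ?canon_all.
- by rewrite addnC.
- by case: l wl {c} => // v l _; rewrite !inE eqxx orbT.
- by rewrite /gval cost_cons mulrDr; lia.
Qed.

(** Removing one of several copies of [w] keeps the head: if [w] is the head, the next entry of the
    nondecreasing list is [w] again. So the value changes by the scaled cost of [w] alone, and the
    value of [l] is found by a push along [w] from the smaller list. *)
Lemma gval_rem l w : canon l -> w \in l -> w \in rem w l ->
  [/\ canon (rem w l), sumn l = sumn (rem w l) + w
    & gval l = (gval (rem w l) + S%:Z * q w)%R].
Proof.
move=> c wl wr; have cr := canon_subseq (rem_subseq w l) c.
have e := perm_to_rem wl; split=> //.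
  by rewrite (perm_sumn e) addnC.
rewrite /gval (perm_cost e) cost_cons mulrDr.
suff -> : head 0 (rem w l) = head 0 l by lia.
case: l c wl wr cr e => //= v l c wl wr cr _.
move: wr cr; case: eqP => [<-|//] wr cr.
case: l c wl wr cr => // x l c _ wr cr /=.
apply/eqP; rewrite eqn_leq; apply/andP; split.
  by move: wr; rewrite inE => /orP[/eqP -> //|]; apply: canon_head_le cr _.
by apply: canon_head_le c _ _; rewrite inE eqxx.
Qed.

(** * Truncated products of cost tables *)

Variables (K M B : nat).
Hypothesis q_bound : forall w, av w -> `|(S%:Z * q w)%R|%N <= K.
Hypothesis M_pos : 0 < M.
Hypothesis MB : K * B + u <= M.

(* Finite entries have magnitude at most [M].  A sum of two entries exceeds
   [thr] exactly when one of them is [inf]. *)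
Let thr : int := (2 * M)%N.
Let inf : int := (4 * M)%N.

Lemma scaled_cost_bound l : all av l -> `|(S%:Z * cost l)%R|%N <= K * sumn l.
Proof.
elim: l => [|w l IH] /=; first by rewrite cost_nil mulr0.
move=> /andP[avw /IH]; rewrite cost_cons mulrDr mulnDr.
have /andP[w0 _] := av_range avw; have := q_bound avw.
have : K <= K * w by rewrite leq_pmulr.
lia.
Qed.

Lemma gval_bound l : canon l -> `|gval l|%N <= K * sumn l + u.
Proof.
move=> c; have := scaled_cost_bound (canon_all c); rewrite /gval.
have : head 0 l <= u by case: l c => // w l /canon_all /= /andP[/av_range/andP[]].
lia.
Qed.

Lemma attained_bound v c : attained v c -> `|v|%N <= K * c + u.
Proof.
move=> [l [x [a <- xl ->]]]; have := scaled_cost_bound a.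
by have /av_range := allP a _ xl; lia.
Qed.

(** The entries need not be the exact minima over lists of length at most [k]: they may already come
    from longer lists. This looser condition is stable under products. *)
Definition best_upto (k : nat) (h : nat -> int) : Prop := forall c, c < B ->
  (h c = inf \/ exists2 l, all av l & sumn l = c /\ h c = (S%:Z * cost l)%R) /\
  (forall l, all av l -> sumn l = c -> size l <= k -> (h c <= S%:Z * cost l)%R).

Definition truncated_conv (X Y Z : nat -> int) : Prop := forall c, c < B ->
  (Z c = inf \/ exists a b, [/\ a + b = c, Z c = (X a + Y b)%R & (Z c <= thr)%R]) /\
  (forall a b, a + b = c -> (X a + Y b <= thr)%R -> (Z c <= X a + Y b)%R).

Lemma scaled_cost_boundB l : all av l -> sumn l < B -> `|(S%:Z * cost l)%R|%N <= M.
Proof.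
move=> a lB; apply: leq_trans (scaled_cost_bound a) _; apply: leq_trans MB.
by rewrite (leq_trans _ (leq_addr _ _)) // leq_mul2l (ltnW lB) orbT.
Qed.

(** A list of length at most [k + k] is cut into two of length at most [k]. A sum with an [inf]
    entry is at least [4 * M - M], so the threshold [2 * M] rejects it; the sum for the cut list is
    at most the scaled cost of the whole, hence at most [M], and is kept. *)
Lemma best_upto_double k X Y Z : best_upto k X -> best_upto k Y ->
  truncated_conv X Y Z -> best_upto (k + k) Z.
Proof.
move=> hX hY hZ c cB; have [s m] := hZ c cB; split.
  case: s => [->|[a [b [abc -> le]]]]; first by left.
  have [[e|[l1 a1 [s1 e1]]] _] := hX a ltac:(lia);
  have [[e'|[l2 a2 [s2 e2]]] _] := hY b ltac:(lia).
  - by move: le; rewrite /thr e e' /inf; lia.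
  - have := scaled_cost_boundB a2; move: le; rewrite /thr e e2 /inf s2; lia.
  - have := scaled_cost_boundB a1; move: le; rewrite /thr e' e1 /inf s1; lia.
  - right; exists (l1 ++ l2); first by rewrite all_cat a1.
    by rewrite sumn_cat s1 s2 cost_cat e1 e2 mulrDr.
move=> l al sl ll.
have := al; rewrite -{1}(cat_take_drop k l) all_cat => /andP[a1 a2].
have sl' : sumn (take k l) + sumn (drop k l) = c by rewrite -sumn_cat cat_take_drop.
have [_ h1] := hX (sumn (take k l)) ltac:(lia).
have [_ h2] := hY (sumn (drop k l)) ltac:(lia).
have le1 := h1 _ a1 erefl ltac:(rewrite size_take; case: ifP; lia).
have le2 := h2 _ a2 erefl ltac:(rewrite size_drop; lia).
have ec : (S%:Z * cost l = S%:Z * cost (take k l) + S%:Z * cost (drop k l))%R.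
  by rewrite -mulrDr -cost_cat cat_take_drop.
have := scaled_cost_boundB al; rewrite sl => /(_ cB) hM.
by have := m _ _ sl'; rewrite /thr; lia.
Qed.

Lemma best_upto_init A h : A 0 = inf ->
  (forall w, w < B -> A w = if av w then (S%:Z * q w)%R else inf) ->
  h 0 = 0%R -> (forall w, 0 < w < B -> h w = A w) -> best_upto 1 h.
Proof.
move=> A0 hA h0 hh c cB; have [->|c0] := posnP c.
  rewrite h0; split; first by right; exists [::]; rewrite ?cost_nil ?mulr0.
  by case=> [|w l] /=; rewrite ?cost_nil ?mulr0 // => /andP[/av_range]; lia.
rewrite hh ?c0 // hA //; split.
  case: ifP => avc; last by left.
  right; exists [:: c]; rewrite /= ?avc ?addn0 //.
  by rewrite cost_cons cost_nil addr0.
case=> [|w [|v l]] //=; first by lia.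
by rewrite andbT addn0 cost_cons cost_nil addr0 => avw <- _; rewrite avw.
Qed.

(** The left factor supplies one weight with its tag, the right factor the remaining list. Every
    list of sum below [B] has length below [B <= k], so the remaining lists are all taken into
    account. *)
Lemma first_weight_conv k X Y Z : B <= k -> best_upto k Y ->
  (forall w, w < B -> X w = if av w then (S%:Z * q w + w%:Z)%R else inf) ->
  truncated_conv X Y Z -> forall c, c < B ->
  (Z c = inf \/ attained (Z c) c) /\
  (forall l, canon l -> sumn l = c -> 0 < c -> (Z c <= gval l)%R).
Proof.
move=> Bk hY hX hZ c cB; have [s m] := hZ c cB; split.
  case: s => [->|[a [b [abc -> le]]]]; [by left | right].
  move: le; rewrite hX; last lia.
  have [[e|[l al [sl ->]]] _] := hY b ltac:(lia).
    case: ifP => ava; last by rewrite e /thr /inf; lia.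
    have := scaled_cost_boundB (l := [:: a]);
      rewrite /= ava /= addn0 => /(_ isT ltac:(lia)).
    rewrite cost_cons cost_nil addr0 e /thr /inf; lia.
  case: ifP => ava; last first.
    by have := scaled_cost_boundB al ltac:(lia); rewrite /thr /inf; lia.
  exists (a :: l), a; rewrite inE eqxx /= ava al sl cost_cons mulrDr.
  by split=> //; lia.
case=> [|w l] cl sl c0; first by rewrite -sl in c0.
have /= /andP[avw al] := canon_all cl.
have sl' : w + sumn l = c by [].
have [_ h] := hY (sumn l) ltac:(lia).
have le := h l al erefl ltac:(have := size_le_sumn al; lia).
have hg : (S%:Z * q w + w%:Z + S%:Z * cost l = gval (w :: l))%R.
  by rewrite /gval cost_cons mulrDr /=; lia.
have gb := gval_bound cl.
have : K * sumn (w :: l) <= K * B by rewrite leq_mul2l sl (ltnW cB) orbT.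
have := m _ _ sl'; rewrite hX; last lia.
rewrite avw /thr; lia.
Qed.

Lemma best_upto_eq k h h' : (forall c, c < B -> h' c = h c) ->
  best_upto k h -> best_upto k h'.
Proof. by move=> e H c cB; rewrite e //; apply: H. Qed.

End Canonical.

(** * Timed specifications of RAM programs *)

Lemma reg_set s r v r' :
  reg (set_reg s r v) r' = if eqn r' r then v else reg s r'.
Proof. by []. Qed.

Lemma reg_set_cell s b i v r : reg (set_cell s b i v) r = reg s r.
Proof. by []. Qed.

Lemma cell_set_reg s r v b i : cell (set_reg s r v) b i = cell s b i.
Proof. by []. Qed.

Lemma cell_set s b i v b' i' : cell (set_cell s b i v) b' i' =
  if eqn b' b then if i' == i then v else cell s b' i' else cell s b' i'.
Proof. by rewrite eqnE /=; case: (b' == b). Qed.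

Lemma fits_set_reg W s r v : `|v|%N <= W -> fits W s -> fits W (set_reg s r v).
Proof. by move=> hv [h1 h2]; split=> // r' /=; case: eqP. Qed.

Lemma fits_set_cell W s b i v : `|v|%N <= W -> fits W s -> fits W (set_cell s b i v).
Proof. by move=> hv [h1 h2]; split=> // b' i' /=; case: ifP. Qed.

Lemma exec_fits W c s k s' : exec W c s k s' -> fits W s -> fits W s'.
Proof.
elim=> {c s k s'}; do ?by move=> *; auto.
- by move=> *; apply: fits_set_reg.
- by move=> *; apply: fits_set_reg.
- by move=> *; apply: fits_set_reg.
- by move=> b x r i s _ f; apply: fits_set_cell => //; case: f.
Qed.

Fixpoint writes_reg (c : cmd) (r : nat) : bool :=
  match c with
  | Const r' _ | Op _ r' _ _ | Read r' _ _ => eqn r r'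
  | Seq c1 c2 | If _ c1 c2 => writes_reg c1 r || writes_reg c2 r
  | While _ c1 => writes_reg c1 r
  | _ => false
  end.

Fixpoint writes_bank (c : cmd) (b : nat) : bool :=
  match c with
  | Write b' _ _ => eqn b b'
  | Seq c1 c2 | If _ c1 c2 => writes_bank c1 b || writes_bank c2 b
  | While _ c1 => writes_bank c1 b
  | _ => false
  end.

(** The write sets are syntactic, so the preservation of a given register or bank is settled by
    computing a boolean. *)
Definition frame (c : cmd) (s s' : state) : Prop :=
  (forall r, ~~ writes_reg c r -> reg s' r = reg s r) /\
  (forall b, ~~ writes_bank c b -> forall i, cell s' b i = cell s b i).

Lemma exec_frame W c s k s' : exec W c s k s' -> frame c s s'.
Proof.
rewrite /frame.
elim=> {c s k s'} /=.
- by [].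
- by move=> r v s _; split=> // r'; rewrite eqnE; case: eqP.
- by move=> o r x y s _; split=> // r'; rewrite eqnE; case: eqP.
- by move=> r b x i s _ _; split=> // r'; rewrite eqnE; case: eqP.
- by move=> b x r i s _; split=> // b'; rewrite eqnE; case: eqP.
- move=> c1 c2 s1 s2 s3 k1 k2 _ [r1 b1] _ [r2 b2]; split=> [r|b];
    rewrite negb_or => /andP[n1 n2]; first by rewrite r2 ?r1.
  by move=> i; rewrite b2 ?b1.
- move=> t c1 c2 s s' k _ _ [r1 b1]; split=> [r|b];
    by rewrite negb_or => /andP[n1 n2]; auto.
- move=> t c1 c2 s s' k _ _ [r1 b1]; split=> [r|b];
    by rewrite negb_or => /andP[n1 n2]; auto.
- by [].
- move=> t c s1 s2 s3 k1 k2 _ _ [r1 b1] _ [r2 b2]; split=> [r|b] n1.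
    by rewrite r2 ?r1.
  by move=> i; rewrite b2 ?b1.
Qed.

Lemma frame_trans c s1 s2 s3 : frame c s1 s2 -> frame c s2 s3 -> frame c s1 s3.
Proof.
by move=> [r1 b1] [r2 b2]; split=> [r|b] n; [rewrite r2 ?r1 | move=> i; rewrite b2 ?b1].
Qed.

(** Fitting is a premise inside the definition: reads depend on it, and [exec_fits] carries it
    through a program. *)
Definition terminates W (c : cmd) (s : state) (k : nat) (Q : state -> Prop) : Prop :=
  fits W s -> exists k' s', [/\ exec W c s k' s', k' <= k & Q s'].

Section Rules.
Variable W : nat.
Implicit Types (c : cmd) (s : state) (Q : state -> Prop).

Notation ter := (terminates W).

Lemma ter_weaken c s k k' Q Q' : ter c s k Q -> k <= k' ->
  (forall s', frame c s s' -> Q s' -> Q' s') -> ter c s k' Q'.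
Proof.
move=> h le hQ f; have [k1 [s1 [e l q]]] := h f; exists k1, s1; split=> //.
  exact: leq_trans l le.
exact: hQ (exec_frame e) q.
Qed.

Lemma ter_le c s k k' Q : ter c s k Q -> k <= k' -> ter c s k' Q.
Proof. by move=> h le; apply: ter_weaken h le _. Qed.

Lemma ter_skip s Q k : Q s -> ter Skip s k.+1 Q.
Proof. by move=> q _; exists 1, s; split=> //; exact: ExecSkip. Qed.

Lemma ter_done s Q : Q s -> ter Skip s 1 Q.
Proof. exact: ter_skip. Qed.

Lemma ter_seq c1 c2 s k1 k2 Q1 Q : ter c1 s k1 Q1 ->
  (forall s1, frame c1 s s1 -> Q1 s1 -> ter c2 s1 k2 Q) ->
  ter (Seq c1 c2) s (k1 + k2) Q.
Proof.
move=> h1 h2 f; have [i [s1 [e1 l1 q1]]] := h1 f.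
have [j [s2 [e2 l2 q2]]] := h2 s1 (exec_frame e1) q1 (exec_fits e1 f).
by exists (i + j), s2; split=> //; [exact: ExecSeq e1 e2 | exact: leq_add].
Qed.

Lemma ter_const r v c s k Q : `|v|%N <= W -> ter c (set_reg s r v) k Q ->
  ter (Seq (Const r v) c) s k.+1 Q.
Proof.
move=> hv h f; have [j [s2 [e2 l2 q2]]] := h (fits_set_reg _ hv f).
exists (1 + j), s2; split=> //; apply: ExecSeq e2; exact: ExecConst.
Qed.

Lemma ter_op v o r x y c s k Q : eval_op o (reg s x) (reg s y) = v -> `|v|%N <= W ->
  ter c (set_reg s r v) k Q -> ter (Seq (Op o r x y) c) s k.+1 Q.
Proof.
move=> e hv h f; have [j [s2 [e2 l2 q2]]] := h (fits_set_reg _ hv f).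
exists (1 + j), s2; split=> //; apply: ExecSeq e2; rewrite -e; apply: ExecOp.
by rewrite e.
Qed.

Lemma ter_read i r b x c s k Q : reg s x = Posz i ->
  ter c (set_reg s r (cell s b i)) k Q -> ter (Seq (Read r b x) c) s k.+1 Q.
Proof.
move=> e h f; have hv := f.2 b i.
have [j [s2 [e2 l2 q2]]] := h (fits_set_reg _ hv f).
by exists (1 + j), s2; split=> //; apply: ExecSeq e2; apply: ExecRead.
Qed.

Lemma ter_write i r b x c s k Q : reg s x = Posz i ->
  ter c (set_cell s b i (reg s r)) k Q -> ter (Seq (Write b x r) c) s k.+1 Q.
Proof.
move=> e h f; have [j [s2 [e2 l2 q2]]] := h (fits_set_cell _ _ (f.1 r) f).
by exists (1 + j), s2; split=> //; apply: ExecSeq e2; apply: ExecWrite.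
Qed.

Lemma ter_if t c1 c2 s k Q : (eval_test t s -> ter c1 s k Q) ->
  (~~ eval_test t s -> ter c2 s k Q) -> ter (If t c1 c2) s k.+1 Q.
Proof.
move=> h1 h2 f; have [t1|t1] := boolP (eval_test t s).
  have [j [s2 [e2 l2 q2]]] := h1 t1 f.
  by exists j.+1, s2; split=> //; apply: ExecIfTrue.
have [j [s2 [e2 l2 q2]]] := h2 t1 f.
by exists j.+1, s2; split=> //; apply: ExecIfFalse.
Qed.

(** Running the continuation inside each branch avoids an intermediate assertion at the join;
    [ter_seqA] and [ter_skip_seq] then bring the branch into the shape of the other rules. *)
Lemma ter_if_seq t c1 c2 c s k Q :
  (eval_test t s -> ter (Seq c1 c) s k Q) ->
  (~~ eval_test t s -> ter (Seq c2 c) s k Q) ->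
  ter (Seq (If t c1 c2) c) s k.+1 Q.
Proof.
move=> h1 h2 f; have [t1|t1] := boolP (eval_test t s).
  have [j [s2 [e2 l2 q2]]] := h1 t1 f; inversion e2; subst.
  by eexists; exists s2; split; [apply: ExecSeq; [apply: ExecIfTrue|] | |]; eauto.
have [j [s2 [e2 l2 q2]]] := h2 t1 f; inversion e2; subst.
by eexists; exists s2; split; [apply: ExecSeq; [apply: ExecIfFalse|] | |]; eauto.
Qed.

Lemma ter_seqA c1 c2 c s k Q : ter (Seq c1 (Seq c2 c)) s k Q ->
  ter (Seq (Seq c1 c2) c) s k Q.
Proof.
move=> h f; have [j [s2 [e2 l2 q2]]] := h f.
inversion e2; subst;
  match goal with H : exec _ (Seq c2 c) _ _ _ |- _ => inversion H end; subst.
eexists; exists s2; split; [apply: ExecSeq; [apply: ExecSeq|] | |]; eauto.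
by rewrite -addnA.
Qed.

Lemma ter_skip_seq c s k Q : ter c s k Q -> ter (Seq Skip c) s k.+1 Q.
Proof.
move=> h f; have [j [s2 [e2 l2 q2]]] := h f.
by exists (1 + j), s2; split=> //; apply: ExecSeq e2; exact: ExecSkip.
Qed.

(* The invariant counts the iterations that remain. *)
Lemma ter_while_down (I : nat -> state -> Prop) kb t c s n :
  (forall s', frame c s s' -> I 0 s' -> ~~ eval_test t s') ->
  (forall j s', j < n -> frame c s s' -> I j.+1 s' ->
     eval_test t s' /\ ter c s' kb (I j)) ->
  I n s -> ter (While t c) s (n * kb.+1).+1 (I 0).
Proof.
move=> h0 hS; have : frame c s s by [].
suff H m s' : m <= n -> frame c s s' -> I m s' ->
    ter (While t c) s' (m * kb.+1).+1 (I 0).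
  exact: H.
elim: m s' => [|m IH] s' mn fr i f.
  by exists 1, s'; split=> //; apply: ExecWhileFalse; apply: h0.
have [t1 hb] := hS _ _ mn fr i; have [k1 [s1 [e1 l1 q1]]] := hb f.
have fr1 : frame c s s1 := frame_trans fr (exec_frame e1).
have [k2 [s2 [e2 l2 q2]]] := IH _ (ltnW mn) fr1 q1 (exec_fits e1 f).
exists (k1 + k2).+1, s2; split=> //; first exact: ExecWhileTrue e1 e2.
lia.
Qed.

Lemma ter_while (I : nat -> state -> Prop) kb t c s n :
  (forall s', frame c s s' -> I n s' -> ~~ eval_test t s') ->
  (forall j s', j < n -> frame c s s' -> I j s' ->
     eval_test t s' /\ ter c s' kb (I j.+1)) ->
  I 0 s -> ter (While t c) s (n * kb.+1).+1 (I n).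
Proof.
move=> hn hS i0; have := @ter_while_down (fun m => I (n - m)) kb t c s n.
rewrite subn0 subnn; apply=> // j s' jn fr.
have -> : n - j = (n - j.+1).+1 by lia.
by apply: hS => //; lia.
Qed.

End Rules.

(* Shifting makes room for the registers and banks of a calling program. *)
Definition shift_test (d : nat) (t : test) : test :=
  match t with
  | TLt x y => TLt (d + x) (d + y)
  | TLe x y => TLe (d + x) (d + y)
  | TEq x y => TEq (d + x) (d + y)
  end.

Fixpoint shift (d : nat) (c : cmd) : cmd :=
  match c with
  | Skip => Skip
  | Const r v => Const (d + r) v
  | Op o r x y => Op o (d + r) (d + x) (d + y)
  | Read r b x => Read (d + r) (d + b) (d + x)
  | Write b x r => Write (d + b) (d + x) (d + r)
  | Seq c1 c2 => Seq (shift d c1) (shift d c2)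
  | If t c1 c2 => If (shift_test d t) (shift d c1) (shift d c2)
  | While t c1 => While (shift_test d t) (shift d c1)
  end.

Definition upper (d : nat) (s : state) : state :=
  State (fun r => reg s (d + r)) (fun b i => cell s (d + b) i).

(** Pointwise equality of states avoids function extensionality. *)
Definition same_state (s s' : state) : Prop :=
  reg s =1 reg s' /\ cell s =2 cell s'.

Lemma eval_shift_test d t s s' : same_state (upper d s) s' ->
  eval_test (shift_test d t) s = eval_test t s'.
Proof. by case: t => x y [e _] /=; rewrite -!e. Qed.

Lemma exec_shift W d c s k s' : exec W c s k s' ->
  forall z, same_state (upper d z) s ->
  exists2 z', exec W (shift d c) z k z' & same_state (upper d z') s'.
Proof.
elim=> {c s k s'} /=.
- by move=> s z e; exists z => //; apply: ExecSkip.
- move=> r v s hv z [e1 e2]; exists (set_reg z (d + r) v); first exact: ExecConst.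
  by split=> [r'|b i] /=; [rewrite eqn_add2l -e1 | apply: e2].
- move=> o r x y s hv z [e1 e2].
  exists (set_reg z (d + r) (eval_op o (reg z (d + x)) (reg z (d + y)))).
    by apply: ExecOp; move: hv; rewrite -!e1.
  by split=> [r'|b i] /=; [rewrite eqn_add2l -!e1 | apply: e2].
- move=> r b x i s hx hv z [e1 e2].
  exists (set_reg z (d + r) (cell z (d + b) i)).
    by apply: ExecRead; [rewrite -hx -e1 | move: hv; rewrite -e2].
  by split=> [r'|b' i'] /=; [rewrite eqn_add2l -!e1 -e2 | apply: e2].
- move=> b x r i s hx z [e1 e2].
  exists (set_cell z (d + b) i (reg z (d + r))).
    by apply: ExecWrite; rewrite -hx -e1.
  by split=> [r'|b' i'] /=; [apply: e1 | rewrite eqn_add2l -e1 -e2].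
- move=> c1 c2 s1 s2 s3 k1 k2 _ h1 _ h2 z e.
  have [z1 x1 /h2[z2 x2 e2]] := h1 z e; exists z2 => //; exact: ExecSeq x1 x2.
- move=> t c1 c2 s s' k ht _ h z e; have [z1 x1 e1] := h z e.
  by exists z1 => //; apply: ExecIfTrue => //; rewrite (eval_shift_test _ e).
- move=> t c1 c2 s s' k ht _ h z e; have [z1 x1 e1] := h z e.
  by exists z1 => //; apply: ExecIfFalse => //; rewrite (eval_shift_test _ e).
- move=> t c s ht z e; exists z => //; apply: ExecWhileFalse.
  by rewrite (eval_shift_test _ e).
- move=> t c s1 s2 s3 k1 k2 ht _ h1 _ h2 z e.
  have [z1 x1 /h2[z2 x2 e2]] := h1 z e; exists z2 => //.
  by apply: ExecWhileTrue x1 x2; rewrite (eval_shift_test _ e).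
Qed.

Lemma writes_reg_shift d c r : r < d -> writes_reg (shift d c) r = false.
Proof.
move=> rd; elim: c => //=.
- by move=> r' _; rewrite eqnE; apply/eqP; lia.
- by move=> _ r' _ _; rewrite eqnE; apply/eqP; lia.
- by move=> r' _ _; rewrite eqnE; apply/eqP; lia.
- by move=> c1 -> c2 ->.
- by move=> _ c1 -> c2 ->.
Qed.

Lemma writes_bank_shift d c b : b < d -> writes_bank (shift d c) b = false.
Proof.
move=> rd; elim: c => //=.
- by move=> b' _ _; rewrite eqnE; apply/eqP; lia.
- by move=> c1 -> c2 ->.
- by move=> _ c1 -> c2 ->.
Qed.

Lemma fits_upper W d s : fits W s -> fits W (upper d s).
Proof. by move=> [h1 h2]; split=> [r|b i] /=; auto. Qed.

(** A step changes at most one cell, so the number of changed cells is a lower bound on the running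
    time. The injection [f] picks a finite set of cells to look at. *)
Lemma exec_changes W c s k s' b (I : finType) (f : I -> nat) : injective f ->
  exec W c s k s' -> #|[set i | cell s' b (f i) != cell s b (f i)]| <= k.
Proof.
move=> finj; elim=> {c s k s'}.
- by move=> s; rewrite eq_card0 // => z; rewrite !inE /= eqxx.
- by move=> r v s _; rewrite eq_card0 // => z; rewrite !inE /= eqxx.
- by move=> o r x y s _; rewrite eq_card0 // => z; rewrite !inE /= eqxx.
- by move=> r b' x i s _ _; rewrite eq_card0 // => z; rewrite !inE /= eqxx.
- move=> b' x r j s _; apply/card_le1_eqP => i1 i2; rewrite !inE /=.
  have key i : (if (b == b') && (f i == j) then reg s r else cell s b (f i)) !=
      cell s b (f i) -> f i = j.
    by case: ifP => [/andP[_ /eqP]|] //; rewrite eqxx.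
  by move=> /key e1 /key e2; apply: finj; rewrite e1.
- move=> c1 c2 s1 s2 s3 k1 k2 _ h1 _ h2.
  apply: leq_trans (leq_add h1 h2); rewrite -cardsUI.
  apply: leq_trans (leq_addr _ _); apply: subset_leq_card; apply/subsetP => i.
  by rewrite !inE; apply: contraNT;
    rewrite negb_or !negbK => /andP[/eqP e1 /eqP e2]; rewrite e2 e1.
- by move=> t c1 c2 s s' k _ _ h; apply: leq_trans h _.
- by move=> t c1 c2 s s' k _ _ h; apply: leq_trans h _.
- by move=> t c s _; rewrite eq_card0 // => z; rewrite !inE /= eqxx.
- move=> t c s1 s2 s3 k1 k2 _ _ h1 _ h2.
  apply: leqW; apply: leq_trans (leq_add h1 h2); rewrite -cardsUI.
  apply: leq_trans (leq_addr _ _); apply: subset_leq_card; apply/subsetP => i.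
  by rewrite !inE; apply: contraNT;
    rewrite negb_or !negbK => /andP[/eqP e1 /eqP e2]; rewrite e2 e1.
Qed.

(** * The knapsack program *)

Notation "c1 ;; c2" := (Seq c1 c2) (at level 70, right associativity).

Ltac lookup := repeat
  progress (rewrite ?(reg_set, reg_set_cell, cell_set_reg, cell_set); cbn [eqn]).
Ltac clean_regs := rewrite /eval_op; lookup;
  repeat match goal with
  | H : reg ?s ?r = _ |- context [reg ?s ?r] => rewrite H
  end.

(* Registers 0-14 hold the constants listed in [env] below.  Banks: 4, scaled
   cost of each weight; 5 and 6, operands of products; 7, their result and later
   the values [gval]; 8, first weight of the canonical multiset; 9, its sum
   without all copies of that weight; 50 and up, memory of the convolution program. *)
Definition fill b hi := While (TLt 20 hi) (Write b 20 10;; Op OAdd 20 20 4;; Skip).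

Definition dup_array src :=
  Const 20 0;;
  While (TLt 20 7)
    (Read 21 src 20;; Write 5 20 21;; Write 6 20 21;; Op OAdd 20 20 4;; Skip);;
  Skip.

(** Registers 40 and 41 hold the offsets of the two blocks. Entry [k] of their convolution belongs
    to the target [k] above the sum of the offsets, where it is merged by minimum. *)
Definition conv_block c0 :=
  Op OAdd 42 40 3;; Op OAdd 43 41 3;; Const 20 0;;
  While (TLt 20 1)
    (Read 21 6 42;; Write 50 20 21;; Read 21 5 43;; Write 51 20 21;;
     Op OAdd 42 42 4;; Op OAdd 43 43 4;; Op OAdd 20 20 4;; Skip);;
  Op OAdd 50 1 3;;
  shift 50 c0;;
  Op OAdd 42 40 41;; Const 20 0;;
  While (TLt 20 11)
    (Read 21 52 20;;
     If (TLe 21 9)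
       (Read 22 7 42;; If (TLt 21 22) (Write 7 42 21;; Skip) Skip;; Skip)
       Skip;;
     Op OAdd 42 42 4;; Op OAdd 20 20 4;; Skip);;
  Skip.

Definition conv_arrays c0 :=
  Const 20 0;; fill 7 8;; Const 40 0;;
  While (TLt 40 7)
    (Const 41 0;;
     While (TLt 41 7) (conv_block c0;; Op OAdd 41 41 1;; Skip);;
     Op OAdd 40 40 1;; Skip);;
  Skip.

Definition rounds c0 :=
  Const 30 0;;
  While (TLt 30 6) (conv_arrays c0;; dup_array 7;; Op OAdd 30 30 4;; Skip);;
  Skip.

Definition add_weights :=
  Const 20 0;;
  While (TLt 20 7)
    (Read 21 4 20;; If (TLe 21 9) (Op OAdd 21 21 20;; Skip) Skip;;
     Write 6 20 21;; Op OAdd 20 20 4;; Skip);;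
  Skip.

Definition base c0 :=
  dup_array 4;; Const 20 0;; Write 5 20 20;; Write 6 20 20;; rounds c0;;
  add_weights;; conv_arrays c0;; Const 20 0;; Write 7 20 20;;
  Op OAdd 20 7 3;; fill 7 12;; Skip.

(* Register 27 runs through the partial sums left after removing all
   copies of one weight after the other from the canonical multiset of the
   target in register 20. *)
Definition push_chain :=
  While (TLt 3 27)
    (Read 28 8 27;; Op OAdd 29 20 28;; Read 31 4 28;; Op OAdd 31 21 31;;
     Read 32 7 29;; If (TLt 31 32) (Write 7 29 31;; Skip) Skip;;
     Read 27 9 27;; Skip).

(** A final value is [u + 1] times the cost plus the first weight, so quotient and remainder by
    [u + 1] recover both. The conditional computes the link as in [others_cons]. *)
Definition settle :=
  Op ODiv 22 21 5;; Op OMul 23 22 5;; Op OSub 23 21 23;; Write 8 20 23;;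
  Op OSub 24 3 22;; Write 2 20 24;; Write 3 20 4;;
  Op OSub 25 20 23;; Read 26 8 25;;
  If (TEq 26 23) (Read 25 9 25;; Skip) Skip;;
  Write 9 20 25;; Op OAdd 27 20 3;; push_chain;; Skip.

Definition main_loop :=
  Const 20 0;;
  While (TLt 20 14)
    (Read 21 7 20;; If (TLe 21 9) settle (Write 3 20 3;; Skip);;
     Op OAdd 20 20 4;; Skip);;
  Skip.

(** * Correctness and running time of the pieces of the program *)

Section Programs.

Variables (W n u t N B pm M : nat).
Hypothesis u_pos : 0 < u.
Hypothesis N_pos : 0 < N.
Hypothesis B_def : B = N * u.
Hypothesis M_big : B + t + u < M.
Hypothesis W_big : 8 * M + n <= W.

Notation thr := (Posz (2 * M)).
Notation inf := (Posz (4 * M)).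
Notation ter := (terminates W).

Record env s : Prop := Env {
  env0 : reg s 0 = Posz n; env1 : reg s 1 = Posz u; env2 : reg s 2 = Posz t;
  env3 : reg s 3 = Posz 0; env4 : reg s 4 = Posz 1; env5 : reg s 5 = Posz u.+1;
  env6 : reg s 6 = Posz N; env7 : reg s 7 = Posz B; env8 : reg s 8 = Posz (B + B);
  env9 : reg s 9 = thr; env10 : reg s 10 = inf; env11 : reg s 11 = Posz (u + u).-1;
  env12 : reg s 12 = Posz (t + u).+1; env13 : reg s 13 = Posz pm;
  env14 : reg s 14 = Posz t.+1 }.

Lemma env_frame c s s' : all (fun r => ~~ writes_reg c r) (iota 0 15) ->
  frame c s s' -> env s -> env s'.
Proof.
move=> /allP h [f _] e.
by case: e => *; split; rewrite f //; apply: h; rewrite mem_iota.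
Qed.

Lemma env_set_reg s r v : 14 < r -> env s -> env (set_reg s r v).
Proof.
move=> h e; case: e => *; split=> //; rewrite reg_set eqnE; case: eqP => // e;
  by rewrite -e in h.
Qed.

Lemma env_set_cell s b i v : env s -> env (set_cell s b i v).
Proof. by case. Qed.

Ltac use_env := match goal with H : env ?s |- context [reg ?s _] =>
  rewrite ?(env0 H, env1 H, env2 H, env3 H, env4 H, env5 H, env6 H, env7 H, env8 H,
    env9 H, env10 H, env11 H, env12 H, env13 H, env14 H) end.
Ltac sv := clean_regs; try use_env; clean_regs; try done; lia.
Ltac op v := apply: (@ter_op _ v); [by sv | by lia | ].
Ltac rd i := apply: (@ter_read _ i); [by sv | ].
Ltac wr i := apply: (@ter_write _ i); [by sv | ].
Ltac solve_env := first [assumption | apply: env_set_reg;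
  [by []|] | apply: env_set_cell].
Ltac keep_env F := match type of F with frame _ ?s ?s' =>
    have : env s' by apply: (env_frame _ F);
      [rewrite /= ?writes_reg_shift | repeat solve_env]
  end.

Lemma fill_spec s b lo hi h : env s -> reg s 20 = Posz lo -> hi != 20 ->
  reg s hi = Posz h -> h <= W ->
  ter (fill b hi) s ((h - lo) * 4).+1 (fun s' =>
    (forall i, lo <= i < h -> cell s' b i = inf) /\
    (forall i, i < lo -> cell s' b i = cell s b i)).
Proof.
move=> E e20 hne ehi loh.
pose I j s' := [/\ reg s' 20 = Posz (lo + j),
  forall i, lo <= i < lo + j -> cell s' b i = inf &
  forall i, i < lo -> cell s' b i = cell s b i].
have hr s' : frame (Write b 20 10;; Op OAdd 20 20 4;; Skip) s s' -> reg s' hi = Posz h.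
  by move=> F; rewrite F.1 //; cbn [writes_reg]; rewrite eqnE (negbTE hne).
apply: (ter_weaken (@ter_while W I 3 _ _ _ (h - lo) _ _ _)) => //.
- move=> s' F [e1 _ _]; cbn [eval_test]; rewrite e1 (hr _ F); lia.
- move=> j s' jh F [e1 h1 h2].
  have ehi' := hr _ F.
  keep_env F => E'; split; first by rewrite /= e1 ehi'; lia.
  wr (lo + j); op (Posz (lo + j.+1)); apply: ter_skip; split.
  + by sv.
  + move=> i hi'; lookup; rewrite eqnE eqxx; case: eqP => [_|ne]; first by sv.
    by apply: h1; lia.
  + move=> i hi'; lookup; rewrite eqnE eqxx; case: eqP => [|ne]; first by lia.
    exact: h2.
- by split=> [|i|//]; [rewrite e20 addn0 | lia].
- move=> s' _ [_ h1 h2]; split=> // i hi'; apply: h1; lia.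
Qed.

Lemma dup_spec s src : env s -> src \in [:: 4; 7] ->
  ter (dup_array src) s (B * 6 + 3) (fun s' => forall i, i < B ->
    cell s' 5 i = cell s src i /\ cell s' 6 i = cell s src i).
Proof.
move=> E src47.
have [src5 src6] : eqn src 5 = false /\ eqn src 6 = false.
  by move: src47; rewrite !inE => /orP[/eqP|/eqP] ->.
rewrite (_ : B * 6 + 3 = ((B * 6).+1 + 1).+1); last by lia.
apply: ter_const; first by lia.
pose I j s' := reg s' 20 = Posz j /\
  forall i, i < j -> cell s' 5 i = cell s src i /\ cell s' 6 i = cell s src i.
apply: ter_seq; first apply: (@ter_while W I 5 _ _ _ B).
- move=> s' F [e1 _]; keep_env F => E'.
  by cbn [eval_test]; rewrite e1 (env7 E'); lia.
- move=> j s' jh F [e1 h1]; keep_env F => E'.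
  split; first by cbn [eval_test]; rewrite e1 (env7 E'); lia.
  rd j; wr j; wr j; op (Posz j.+1); apply: ter_skip; split; first by sv.
  have hc : cell s' src j = cell s src j.
    by rewrite F.2 //; cbn [writes_bank]; rewrite src5 src6.
  move=> i hi; lookup; rewrite hc; case: eqP => [-> //|ne]; apply: h1; lia.
- by [].
- by move=> s1 _ [_ h]; apply: ter_skip.
Qed.

(** * Products of long arrays from convolutions of blocks *)

Variables (c0 : cmd) (Tu : nat).
Hypothesis conv_run : forall s, reg s 50 = Posz u ->
  (forall i, i < u -> `|cell s 50 i|%N <= 4 * M /\ `|cell s 51 i|%N <= 4 * M) ->
  ter (shift 50 c0) s Tu (fun s' => forall k, k < (u + u).-1 ->
    (exists i j, [/\ i < u, j < u, i + j = k &
       cell s' 52 k = (cell s 50 i + cell s 51 j)%R]) /\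
    (forall i j, i < u -> j < u -> i + j = k ->
       (cell s' 52 k <= cell s 50 i + cell s 51 j)%R)).

(** Bank 7 is only ever lowered, and only to genuine sums within the threshold. This monotonicity
    lets the surrounding loops accumulate what the single blocks achieve. *)
Lemma conv_block_spec s a0 b0 : env s ->
  reg s 40 = Posz a0 -> reg s 41 = Posz b0 -> a0 + u <= B -> b0 + u <= B ->
  (forall i, i < B -> `|cell s 6 i|%N <= 4 * M /\ `|cell s 5 i|%N <= 4 * M) ->
  ter (conv_block c0) s (Tu + 32 * u) (fun s' =>
    [/\ forall c, (cell s' 7 c <= cell s 7 c)%R,
        forall c, cell s' 7 c = cell s 7 c \/ exists a b, [/\ a < B, b < B, a + b = c,
          cell s' 7 c = (cell s 6 a + cell s 5 b)%R & (cell s' 7 c <= thr)%R] &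
        forall a b, a0 <= a < a0 + u -> b0 <= b < b0 + u ->
          (cell s 6 a + cell s 5 b <= thr)%R ->
          (cell s' 7 (a + b) <= cell s 6 a + cell s 5 b)%R]).
Proof.
move=> E e40 e41 a0u b0u hb.
(* The sum follows the nesting of the commands, as the timed rules require; [u + 2] is slack. *)
have -> : Tu + 32 * u =
    ((u * 9).+1 + (Tu + (((u + u).-1 * 11).+1 + 1).+2).+1).+3 + (u + 2).
  by lia.
apply: ter_le (leq_addr _ _).
op (Posz a0); op (Posz b0); apply: ter_const; first by lia.
pose I j s' := [/\ reg s' 42 = Posz (a0 + j), reg s' 43 = Posz (b0 + j),
  reg s' 20 = Posz j &
  forall i, i < j ->
    cell s' 50 i = cell s 6 (a0 + i) /\ cell s' 51 i = cell s 5 (b0 + i)].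
apply: ter_seq; first apply: (@ter_while W I 8 _ _ _ u).
- by move=> s' F [_ _ e1 _]; keep_env F => E'; cbn [eval_test];
    rewrite e1 (env1 E'); lia.
- move=> j s' ju F [e1 e2 e3 h1]; keep_env F => E'.
  split; first by cbn [eval_test]; rewrite e3 (env1 E'); lia.
  rd (a0 + j); wr j; rd (b0 + j); wr j; op (Posz (a0 + j.+1)); op (Posz (b0 + j.+1)).
  op (Posz j.+1); apply: ter_skip; split; [sv | sv | sv |].
  have c6 k : cell s' 6 k = cell s 6 k by rewrite F.2.
  have c5 k : cell s' 5 k = cell s 5 k by rewrite F.2.
  move=> i hi; lookup; rewrite c6 c5.
  by case: eqP => [-> //|ne]; apply: h1; lia.
- by split; rewrite ?addn0.
move=> s1 F1 [_ _ _ h1]; keep_env F1 => E1.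
op (Posz u).
have b1 i : i < u -> `|cell (set_reg s1 50 u) 50 i|%N <= 4 * M /\
    `|cell (set_reg s1 50 u) 51 i|%N <= 4 * M.
  move=> iu; lookup; have [-> ->] := h1 i iu.
  by split; [apply: (hb _ _).1 | apply: (hb _ _).2]; lia.
apply: ter_seq; first exact: conv_run b1.
move=> s2 F2 h2; keep_env F2 => E2.
have e40' : reg s2 40 = Posz a0.
  by rewrite F2.1 ?writes_reg_shift //; lookup; rewrite F1.1 //; sv.
have e41' : reg s2 41 = Posz b0.
  by rewrite F2.1 ?writes_reg_shift //; lookup; rewrite F1.1 //; sv.
have c7 i : cell s2 7 i = cell s 7 i.
  by rewrite F2.2 ?writes_bank_shift //; lookup; rewrite F1.2.
op (Posz (a0 + b0)); apply: ter_const; first by lia.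
pose J j s' := [/\ reg s' 42 = Posz (a0 + b0 + j), reg s' 20 = Posz j,
  forall c, (cell s' 7 c <= cell s 7 c)%R,
  forall c, cell s' 7 c = cell s 7 c \/ exists k, [/\ k < (u + u).-1,
     c = a0 + b0 + k, cell s' 7 c = cell s2 52 k & (cell s' 7 c <= thr)%R] &
  forall k, k < j -> (cell s2 52 k <= thr)%R ->
    (cell s' 7 (a0 + b0 + k) <= cell s2 52 k)%R].
apply: ter_seq; first apply: (@ter_while W J 10 _ _ _ (u + u).-1).
- by move=> s' F [_ e1 _ _ _]; keep_env F => E'; cbn [eval_test];
    rewrite e1 (env11 E'); lia.
- move=> j s' ju F [e1 e2 g1 g2 g3]; keep_env F => E'.
  split; first by cbn [eval_test]; rewrite e2 (env11 E'); lia.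
  have c52 i : cell s' 52 i = cell s2 52 i by rewrite F.2.
  rd j; apply: ter_if_seq; cbn [eval_test]; lookup; rewrite (env9 E') c52 => cmp1.
  + apply: ter_seqA; rd (a0 + b0 + j); apply: ter_seqA.
    apply: ter_if_seq; cbn [eval_test]; lookup; rewrite ?c52 => cmp2.
    * apply: ter_seqA; wr (a0 + b0 + j); do 2 apply: ter_skip_seq.
      op (Posz (a0 + b0 + j.+1)); op (Posz j.+1); apply: ter_skip; split;
        [by sv | by sv | | |].
      - move=> c; lookup; rewrite ?c52; case: eqP => [->|//]; have := g1 (a0 + b0 + j).
        by lia.
      - move=> c; lookup; rewrite ?c52; case: eqP => [->|ne]; last exact: g2.
        by right; exists j.
      - move=> k kj; lookup; rewrite ?c52; case: eqP => [e|ne] kt.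
          by have -> : k = j by lia.
        by apply: g3 => //; lia.
    * do 2 apply: ter_skip_seq.
      op (Posz (a0 + b0 + j.+1)); op (Posz j.+1); apply: ter_skip; split;
        [by sv | by sv | by [] | by [] |].
      move=> k kj kt; lookup; have [e|ne] := eqVneq k j;
        first by rewrite e in kt *; lia.
      by apply: g3 => //; lia.
  + apply: ter_skip_seq.
    op (Posz (a0 + b0 + j.+1)); op (Posz j.+1); apply: ter_skip; split;
        [by sv | by sv | by [] | by [] |].
    move=> k kj kt; lookup; have [e|ne] := eqVneq k j; first by rewrite e in kt; lia.
    by apply: g3 => //; lia.
- split; [by sv | by [] | | |].
  + by move=> c; lookup; rewrite c7.
  + by move=> c; left; lookup; rewrite c7.
  + by [].
move=> s3 F3 [_ _ g1 g2 g3]; apply: ter_skip; split=> // [c|a b ha hb' le].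
  case: (g2 c) => [|[k [ku -> e7 le]]]; [by left | right].
  have [[i [j [iu ju ijk ev]]] _] := h2 k ku; move: ev; lookup.
  have [-> _] := h1 i iu; have [_ ->] := h1 j ju => ev.
  exists (a0 + i), (b0 + j); split; [lia | lia | lia | by rewrite e7 ev | exact: le].
have ku : (a - a0) + (b - b0) < (u + u).-1 by lia.
have [_ h] := h2 _ ku.
have := h (a - a0) (b - b0) ltac:(lia) ltac:(lia) erefl; lookup.
have [-> _] := h1 (a - a0) ltac:(lia); have [_ ->] := h1 (b - b0) ltac:(lia).
rewrite !subnKC; [|lia|lia] => hle.
have := g3 _ ku (le_trans hle le).
have -> : a0 + b0 + (a - a0 + (b - b0)) = a + b by lia.
by move/le_trans; apply.
Qed.

Lemma conv_spec s : env s ->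
  (forall i, i < B -> `|cell s 6 i|%N <= 4 * M /\ `|cell s 5 i|%N <= 4 * M) ->
  ter (conv_arrays c0) s
    (N * (N * (Tu + 32 * u + 3) + 5) + 8 * B + 5)
    (fun s' => truncated_conv M B (cell s 6) (cell s 5) (cell s' 7)).
Proof.
move=> E hb; eapply ter_le.
apply: ter_const; first by lia.
apply: ter_seq.
  apply: (@fill_spec _ 7 0 8 (B + B));
    [by repeat solve_env | by [] | by [] | by sv | lia].
move=> s1 F1 [h1 _]; keep_env F1 => E1.
apply: ter_const; first by lia.
have c6 i : cell s1 6 i = cell s 6 i by rewrite F1.2.
have c5 i : cell s1 5 i = cell s 5 i by rewrite F1.2.
(* Soundness covers targets up to [B + B], since block products overshoot [B]; only those below [B]
   are kept in the end. *)
pose sound s' := forall c, c < B + B -> cell s' 7 c = inf \/ exists a b,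
  [/\ a + b = c, cell s' 7 c = (cell s 6 a + cell s 5 b)%R & (cell s' 7 c <= thr)%R].
pose complete s' a b := (cell s 6 a + cell s 5 b <= thr)%R ->
  (cell s' 7 (a + b) <= cell s 6 a + cell s 5 b)%R.
pose I ia s' := [/\ reg s' 40 = Posz (ia * u), sound s' &
  forall a b, a < ia * u -> b < B -> complete s' a b].
have hN j : j < N -> j * u + u <= B.
  by move=> jN; rewrite B_def -mulSnr leq_mul2r jN orbT.
apply: ter_seq; first apply: (@ter_while W I _ _ _ _ N).
- by move=> s' F [e1 _ _]; keep_env F => E'; cbn [eval_test]; rewrite e1 (env7 E'); lia.
- move=> ia s' iaN F [e1 g1 g2]; keep_env F => E'; have iau := hN _ iaN.
  split; first by cbn [eval_test]; rewrite e1 (env7 E'); lia.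
  have c6' i : cell s' 6 i = cell s 6 i.
    by rewrite F.2 //= ?writes_bank_shift.
  have c5' i : cell s' 5 i = cell s 5 i.
    by rewrite F.2 //= ?writes_bank_shift.
  apply: ter_const; first by lia.
  pose J ib s'' := [/\ reg s'' 41 = Posz (ib * u), sound s'',
    forall a b, a < ia * u -> b < B -> complete s'' a b &
    forall a b, ia * u <= a < ia * u + u -> b < ib * u -> complete s'' a b].
  apply: ter_seq; first apply: (@ter_while W J _ _ _ _ N).
  + by move=> s2 F2 [e2 _ _ _]; keep_env F2 => E2; cbn [eval_test];
      rewrite e2 (env7 E2); lia.
  + move=> ib s2 ibN F2 [e2 k1 k2 k3]; keep_env F2 => E2; have ibu := hN _ ibN.
    split; first by cbn [eval_test]; rewrite e2 (env7 E2); lia.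
    have d6 i : cell s2 6 i = cell s 6 i.
      by rewrite F2.2 //= ?writes_bank_shift // c6'.
    have d5 i : cell s2 5 i = cell s 5 i.
      by rewrite F2.2 //= ?writes_bank_shift // c5'.
    have e40 : reg s2 40 = Posz (ia * u).
      by rewrite F2.1 //= ?writes_reg_shift.
    apply: ter_seq.
      by apply: conv_block_spec; eauto => i iB; rewrite d6 d5; apply: hb.
    move=> s3 F3 [m1 m2 m3]; keep_env F3 => E3.
    have e41 : reg s3 41 = Posz (ib * u).
      by rewrite F3.1 //= ?writes_reg_shift.
    op (Posz (ib.+1 * u)); apply: ter_done.
    have mono a b : complete s2 a b -> complete s3 a b.
      by move=> h le; apply: le_trans (m1 _) (h le).
    split; first by sv.
    * move=> c cB; lookup; case: (m2 c) => [->|[a [b [aB bB abc e le]]]];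
        first exact: k1.
      by right; exists a, b; rewrite -d6 -d5.
    * by move=> a b ha hb'; apply: mono; apply: k2.
    * move=> a b ha hb'; have [lt|ge] := ltnP b (ib * u).
        by apply: mono; apply: k3.
      move=> le; lookup; rewrite -d6 -d5; apply: m3 => //; first by lia.
      by rewrite d6 d5.
  + split=> //.
  + move=> s2 F2 [e2 k1 k2 k3]; keep_env F2 => E2.
    have e40 : reg s2 40 = Posz (ia * u).
      by rewrite F2.1 //= ?writes_reg_shift.
    op (Posz (ia.+1 * u)); apply: ter_done; split; [by sv | by [] |].
    move=> a b ha hb'; have [lt|ge] := ltnP a (ia * u); first exact: k2.
    by apply: k3; rewrite -?B_def; lia.
- split; [by [] | | by []].
  by move=> c cB; left; lookup; apply: h1.
move=> s2 F2 [_ g1 g2]; apply: ter_done => c cB; split; first by apply: g1; lia.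
by move=> a b abc le; rewrite -abc; apply: g2 => //; rewrite -?B_def; lia.
lia.
Qed.

(** * Repeated squaring and the table of small targets *)

Variables (av : pred nat) (q : nat -> int) (K : nat).
Hypothesis av_range : forall w, av w -> 0 < w <= u.
Hypothesis q_bound : forall w, av w -> `|(u.+1%:Z * q w)%R|%N <= K.
Hypothesis MK : K * (B + (t + u).+1) + u <= M.
Hypothesis N_big : B <= 2 ^ N.

Let M_pos : 0 < M. Proof. lia. Qed.
Let MB : K * B + u <= M.
Proof. by apply: leq_trans MK; rewrite leq_add2r leq_mul2l leq_addr orbT. Qed.

Let NB : N <= B. Proof. by rewrite B_def leq_pmulr. Qed.

Notation best_upto := (best_upto av q u.+1 M B).

Lemma best_upto_bound k h c : best_upto k h -> c < B -> `|h c|%N <= 4 * M.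
Proof.
move=> H cB; have [[->|[l a [s ->]]] _] := H c cB; first by lia.
have := scaled_cost_boundB av_range (ltnSn u) q_bound M_pos MB a.
by rewrite s => /(_ cB); lia.
Qed.

Lemma rounds_spec s : env s -> best_upto 1 (cell s 5) -> best_upto 1 (cell s 6) ->
  ter (rounds c0) s
    (N * (N * (N * (Tu + 32 * u + 3) + 5) + 14 * B + 12) + 3)
    (fun s' => best_upto (2 ^ N) (cell s' 5)).
Proof.
move=> E h5 h6; eapply ter_le.
apply: ter_const; first by lia.
pose I j s' := [/\ reg s' 30 = Posz j, best_upto (2 ^ j) (cell s' 5)
  & best_upto (2 ^ j) (cell s' 6)].
apply: ter_seq; first apply: (@ter_while W I _ _ _ _ N).
- by move=> s' F [e _ _]; keep_env F => E'; cbn [eval_test]; rewrite e (env6 E'); lia.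
- move=> j s' jN F [e g5 g6]; keep_env F => E'.
  split; first by cbn [eval_test]; rewrite e (env6 E'); lia.
  apply: ter_seq.
    by apply: conv_spec => // i iB; split; apply: best_upto_bound iB; eassumption.
  move=> s1 F1 h7; keep_env F1 => E1.
  apply: ter_seq; first by apply: dup_spec.
  move=> s2 F2 h2; keep_env F2 => E2.
  have e2 : reg s2 30 = Posz j.
    by rewrite F2.1 // F1.1 //= ?writes_reg_shift.
  op (Posz j.+1); apply: ter_done; split; first by sv.
  + rewrite expnS mul2n -addnn; apply: best_upto_eq.
      by move=> c cB; lookup; exact: (h2 c cB).1.
    exact: (best_upto_double av_range (ltnSn u) q_bound M_pos MB g6 g5 h7).
  + rewrite expnS mul2n -addnn; apply: best_upto_eq.
      by move=> c cB; lookup; exact: (h2 c cB).2.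
    exact: (best_upto_double av_range (ltnSn u) q_bound M_pos MB g6 g5 h7).
- by split.
by move=> s1 F1 [_ h _]; apply: ter_done.
lia.
Qed.

Definition weight_table s := forall w, w < B ->
  cell s 4 w = if av w then (u.+1%:Z * q w)%R else inf.

Lemma add_weights_spec s : env s -> weight_table s ->
  ter add_weights s (B * 8 + 3) (fun s' => forall w, w < B ->
    cell s' 6 w = if av w then (u.+1%:Z * q w + w%:Z)%R else inf).
Proof.
move=> E ht; eapply ter_le.
apply: ter_const; first by lia.
pose I j s' := reg s' 20 = Posz j /\ forall w, w < j ->
  cell s' 6 w = if av w then (u.+1%:Z * q w + w%:Z)%R else inf.
apply: ter_seq; first apply: (@ter_while W I 7 _ _ _ B).
- by move=> s' F [e _]; keep_env F => E'; cbn [eval_test]; rewrite e (env7 E'); lia.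
- move=> j s' jB F [e h]; keep_env F => E'.
  split; first by cbn [eval_test]; rewrite e (env7 E'); lia.
  have c4 : cell s' 4 j = if av j then (u.+1%:Z * q j)%R else inf.
    by rewrite F.2 //; lookup; apply: ht.
  have KM : av j -> K + u <= M.
    move=> _; apply: leq_trans MK; rewrite leq_add2r -{1}[K]muln1 leq_mul2l.
    by apply/orP; right; lia.
  rd j; rewrite c4; apply: ter_if_seq; cbn [eval_test]; lookup; rewrite (env9 E').
  + case: ifP => avj; last by lia.
    have := q_bound avj => qb _; have := KM avj => KM'.
    apply: ter_seqA; op (u.+1%:Z * q j + j%:Z)%R; apply: ter_skip_seq.
    wr j; op (Posz j.+1); apply: ter_skip; split; first by sv.
    move=> w wj; lookup; case: eqP => [->|ne]; first by rewrite avj.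
    by apply: h; lia.
  + case: ifP => avj; first by have := q_bound avj; have := KM avj; lia.
    move=> _; apply: ter_skip_seq.
    wr j; op (Posz j.+1); apply: ter_skip; split; first by sv.
    move=> w wj; lookup; case: eqP => [->|ne]; first by rewrite avj.
    by apply: h; lia.
- by [].
by move=> s1 _ [_ h]; apply: ter_done.
lia.
Qed.

(** The [N] squarings cover lists of length up to [2 ^ N >= B], which is all lists of sum below [B];
    the final product adds the first weights. Entries from [B] to [t + u] start as [inf] and are
    left to the pushes. *)
Lemma base_spec s : env s -> weight_table s ->
  ter (base c0) s
    ((N + 1) * (N * (N * (Tu + 32 * u + 3) + 5) + 14 * B + 12) +
     15 * B + 4 * (t + u) + 40)
    (fun s' => [/\ cell s' 7 0 = 0%R,
      forall c, 0 < c <= t + u ->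
        cell s' 7 c = inf \/ attained av q u.+1 (cell s' 7 c) c &
      forall c l, c < B -> canon av q l -> sumn l = c -> 0 < c ->
        (cell s' 7 c <= gval q u.+1 l)%R]).
Proof.
move=> E ht; eapply ter_le.
apply: ter_seq; first by apply: dup_spec.
move=> s1 F1 h1; keep_env F1 => E1.
apply: ter_const; first by lia.
(* The weight table has no entry for sum 0; the empty list provides cost 0 there. *)
wr 0; wr 0.
have uB : u <= B by rewrite B_def leq_pmull.
have av0 : av 0 = false by apply/negP => /av_range.
have init h : h 0 = 0%R -> (forall w, 0 < w < B -> h w = cell s 4 w) -> best_upto 1 h.
  move=> h0 hh; apply: (best_upto_init av_range (ltnSn u) M_pos MB _ ht h0 hh).
  by rewrite ht ?av0 //; lia.
apply: ter_seq.
  apply: rounds_spec; [by repeat solve_env | |]; apply: init; lookup => //.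
  - by move=> w wB; lookup; rewrite ifF; [apply: (h1 w _).1 | ]; lia.
  - by move=> w wB; lookup; rewrite ifF; [apply: (h1 w _).2 | ]; lia.
move=> s2 F2 h2; keep_env F2 => E2.
have ht2 : weight_table s2.
  by move=> w wB; rewrite F2.2 //= ?writes_bank_shift //; rewrite F1.2 // ht.
apply: ter_seq; first exact: add_weights_spec.
move=> s3 F3 h3; keep_env F3 => E3.
have h35 : best_upto (2 ^ N) (cell s3 5).
  by apply: best_upto_eq h2 => c cB; rewrite F3.2.
apply: ter_seq.
  apply: conv_spec => // i iB; split; last exact: best_upto_bound h35 iB.
  rewrite h3 //; case: ifP => avi; last by lia.
  have := q_bound avi; have /andP[i0 iu] := av_range avi.
  have : K <= K * (B + (t + u).+1) by rewrite leq_pmulr //; lia.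
  lia.
move=> s4 F4 h4; keep_env F4 => E4.
(* The last product sees only nonempty lists, so entry 0 is set to the value of [[::]]
   afterwards. *)
apply: ter_const; first by lia.
wr 0; op (Posz B).
apply: ter_seq.
  by apply: (@fill_spec _ 7 B 12 (t + u).+1);
    [by repeat solve_env | by sv | by [] | by sv | lia].
move=> s5 F5 [h5 h5']; apply: ter_done.
have h36 w : w < B -> cell s3 6 w = if av w then (u.+1%:Z * q w + w%:Z)%R else inf.
  exact: h3.
have H := first_weight_conv av_range (ltnSn u) q_bound M_pos MB N_big h35 h36 h4.
have c7 c : 0 < c -> c < B -> cell s5 7 c = cell s4 7 c.
  by move=> c0' cB; rewrite h5' //; lookup; rewrite ifF //; lia.
split.
- by rewrite h5' //; lia.
- move=> c cr; have [cB|Bc] := ltnP c B; last by left; apply: h5; lia.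
  by rewrite c7; [apply: (H c _).1 | lia | lia].
- move=> c l cB cl sl c0'; rewrite c7 //; exact: (H c cB).2.
lia.
Qed.

(** * Pushing along canonical multisets *)

Variable J : nat.
Hypothesis N_def : N = J.*2 + 4.
Hypothesis u_lt : u < 2 ^ J.

Notation canon := (canon av q).
Notation gval := (gval q u.+1).
Notation attained := (attained av q u.+1).

Lemma attained_le v d : attained v d -> d <= t + u -> `|v|%N <= M.
Proof.
move=> h dt; apply: leq_trans (attained_bound av_range (ltnSn u) q_bound M_pos MB h) _.
apply: leq_trans MK; rewrite leq_add2r leq_mul2l; apply/orP; right; lia.
Qed.

Lemma gval_le l : canon l -> sumn l <= t + u -> `|gval l|%N <= M.
Proof.
move=> cl lt; have [z|nz] := posnP (sumn l).
  have -> : l = [::] by apply: (canon_unique av_range cl).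
  by rewrite gvalE cost_nil mulr0.
exact: attained_le (attained_gval av_range _ cl nz) lt.
Qed.

(** A push from a target at most [t] reaches at most [t + u]. *)
Definition sound s := forall d, 0 < d <= t + u ->
  cell s 7 d = inf \/ attained (cell s 7 d) d.

(** Links can be indexed by sums because a canonical list is determined by its sum. *)
Definition linked s c := forall l, canon l -> sumn l < c ->
  cell s 8 (sumn l) = Posz (head 0 l) /\
  (l <> [::] -> cell s 9 (sumn l) = Posz (sumn (others l))).

(** The chain of links passes through sub-multisets of [l], all canonical by [canon_subseq], so the
    stored entries describe them. Each round disposes of one distinct weight, and there are fewer
    than [N] of these by [canon_support_lt]. *)
Lemma push_chain_spec s l c : env s -> weight_table s -> canon l -> sumn l = c ->
  c <= t -> reg s 20 = Posz c -> reg s 27 = Posz c -> reg s 21 = gval l ->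
  sound s -> linked s c.+1 ->
  ter push_chain s (N * 11).+1 (fun s' => [/\ sound s',
    forall d, (cell s' 7 d <= cell s 7 d)%R,
    forall d, d <= c -> cell s' 7 d = cell s 7 d &
    forall w, w \in l -> (cell s' 7 (c + w) <= gval l + u.+1%:Z * q w)%R]).
Proof.
move=> E ht cl sl ct e20 e27 e21 so li.
(* Here [l'] is the part of [l] still ahead and [m] its number of distinct weights; each weight of
   [l] is either ahead or already pushed. *)
pose I m s' := exists l', [/\ subseq l' l, size (undup l') = m,
  reg s' 27 = Posz (sumn l'),
  (forall w, w \in l -> w \in l' \/ (cell s' 7 (c + w) <= gval l + u.+1%:Z * q w)%R) &
  [/\ sound s', forall d, (cell s' 7 d <= cell s 7 d)%R &
    forall d, d <= c -> cell s' 7 d = cell s 7 d]].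
have sub_le l' : subseq l' l -> sumn l' <= c.
  by case/subseq_perm => r /perm_sumn; rewrite sumn_cat; lia.
apply: (ter_weaken (@ter_while_down W I 10 _ _ _ (size (undup l)) _ _ _)).
- move=> s' F [l' [sub /size0nil zl e1 _ _]]; keep_env F => E'.
  have l'0 : l' = [::] by case: l' zl {sub e1} => // w l' z;
    have := mem_undup (w :: l') w;
    rewrite z inE eqxx.
  by cbn [eval_test]; rewrite (env3 E') e1 l'0.
- move=> j s' _ F [l' [sub sz e1 h1 [so' le' eq']]]; keep_env F => E'.
  have cl' := canon_subseq sub cl; have sl' := sub_le _ sub.
  case: l' sub sz e1 h1 cl' sl' => // w l' sub sz e1 h1 cl' sl'.
  have wl : w \in l by apply: (mem_subseq sub); rewrite inE eqxx.
  have avw : av w by exact: (allP (canon_all av_range cl) _ wl).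
  have /andP[w0 wu] := av_range avw.
  have [l8 l9] : cell s' 8 (sumn (w :: l')) = Posz w /\
      cell s' 9 (sumn (w :: l')) = Posz (sumn (others (w :: l'))).
    by rewrite !F.2 //; have [-> ->] := li _ cl' sl'.
  have c4 : cell s' 4 w = (u.+1%:Z * q w)%R by rewrite F.2 // ht ?avw //; lia.
  have e20' : reg s' 20 = Posz c by rewrite F.1.
  have e21' : reg s' 21 = gval l by rewrite F.1.
  split; first by cbn [eval_test]; rewrite (env3 E') e1 /=; lia.
  have att := attained_push av_range (ltnSn u) cl wl.
  have attM := attained_le att ltac:(lia).
  rewrite sl in att.
  rd (sumn (w :: l')); rewrite l8; op (Posz (c + w)); rd w; lookup; rewrite c4.
  op (gval l + u.+1%:Z * q w)%R; rd (c + w).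
  have next s1 : reg s1 27 = Posz (sumn (others (w :: l'))) ->
      (forall v, v \in l -> v \in others (w :: l') \/
         (cell s1 7 (c + v) <= gval l + u.+1%:Z * q v)%R) ->
      [/\ sound s1, forall d, (cell s1 7 d <= cell s 7 d)%R &
        forall d, d <= c -> cell s1 7 d = cell s 7 d] -> I j s1.
    move=> k1 k2 k3; exists (others (w :: l')); split=> //.
      exact: subseq_trans (others_subseq _) sub.
    by apply: succn_inj; rewrite size_undup_others.
  have split_mem v : v \in l -> [\/ v = w, v \in others (w :: l') |
      (cell s' 7 (c + v) <= gval l + u.+1%:Z * q v)%R].
    move=> vl; case: (h1 v vl) => [/mem_others[/= ->|h]|h];
      by [constructor 1 | constructor 2 | constructor 3].
  apply: ter_if_seq; cbn [eval_test]; lookup => cmp.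
  + apply: ter_seqA; wr (c + w); apply: ter_skip_seq.
    rd (sumn (w :: l')); lookup; rewrite l9; apply: ter_done.
    apply: next; first by lookup.
    * move=> v vl; lookup; case: eqP => [e|ne].
        by right; have -> : v = w by lia.
      by case: (split_mem v vl) => [e|h|h]; [case: ne; rewrite e | left | right].
    * split=> d; lookup.
      - by move=> dt; case: eqP => [->|_]; [right | apply: so'].
      - case: eqP => [->|_] //; apply: le_trans (le' _); exact: ltW.
      - by move=> dc; rewrite ifF ?eq' //; lia.
  + apply: ter_skip_seq; rd (sumn (w :: l')); lookup; rewrite l9; apply: ter_skip.
    apply: next; first by lookup.
    * move=> v vl; lookup.
      case: (split_mem v vl) => [->|h|h]; [right | by left | by right].
      by rewrite leNgt.
    * by split=> d; lookup; [apply: so' | apply: le' | apply: eq'].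
- exists l; split=> //; [by rewrite sl | by move=> w; left].
- rewrite ltnS leq_mul2r /=; apply: ltnW; rewrite N_def.
  exact: (canon_support_lt av_range u_lt cl).
- move=> s' _ [l' [_ /size0nil zl _ h1 [so' le' eq']]]; split=> // w wl.
  case: (h1 w wl) => //; by rewrite -mem_undup zl.
Qed.

Definition answered s c :=
  (forall l, canon l -> sumn l = c ->
     cell s 3 c = 1%R /\ cell s 2 c = (- cost q l)%R) /\
  ((forall l, all av l -> sumn l <> c) -> cell s 3 c = 0%R).

Definition complete_below s c :=
  (forall d l, d < B -> canon l -> sumn l = d -> 0 < d -> (cell s 7 d <= gval l)%R) /\
  (forall l w, canon l -> sumn l < c -> w \in l ->
     (cell s 7 (sumn l + w) <= gval l + u.+1%:Z * q w)%R).

Definition progress c s :=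
  [/\ cell s 7 0 = 0%R, sound s, complete_below s c, linked s c &
    forall d, d < c -> answered s d].

(** For the upper bound below [B] the base table suffices; from [B = N * u] on, [canon_repeat] gives
    a weight that remains after removing one copy, so it was pushed from the smaller canonical list.
    The lower bound is [gval_min]. An entry [inf] rules out any list, whose value would be at most
    [M]. *)
Lemma progress_value c s : progress c s -> c <= t ->
  (exists l, [/\ canon l, sumn l = c & cell s 7 c = gval l]) \/
  (forall l, all av l -> sumn l <> c) /\ cell s 7 c = inf.
Proof.
move=> [c0' so [b1 b2] _ _] ct.
have [->|cpos] := posnP c.
  by left; exists [::]; split=> //; rewrite c0' gvalE cost_nil mulr0.
have upper l : canon l -> sumn l = c -> (cell s 7 c <= gval l)%R.
  move=> cl sl; have [cB|Bc] := ltnP c B; first exact: b1 sl cpos.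
  have [||w wl wr] := @canon_repeat u av q av_range J l _ cl; first by rewrite u_pos.
    by rewrite -N_def -B_def sl.
  have [cr sr ->] := gval_rem (ltnSn u) cl wl wr.
  rewrite -sl sr; apply: b2 => //.
  by have /av_range := allP (canon_all av_range cl) _ wl; lia.
case: (so c ltac:(lia)) => [vi|att].
  right; split=> // l0 a0 s0; have [l cl sl] := ex_canon q av_range a0.
  rewrite s0 in sl; have := upper l cl sl; have := gval_le cl ltac:(lia).
  by rewrite vi; lia.
left; have [l0 [x [a0 s0 _ _]]] := att.
have [l cl sl] := ex_canon q av_range a0; rewrite s0 in sl.
exists l; split=> //; apply/eqP; rewrite eq_le upper //=.
by apply: (gval_min av_range (ltnSn u) cl); rewrite sl.
Qed.

Lemma settle_spec c s l : env s -> weight_table s -> progress c s -> c <= t ->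
  reg s 20 = Posz c -> reg s 21 = gval l -> cell s 7 c = gval l ->
  canon l -> sumn l = c ->
  ter settle s (N * 11 + 20) (progress c.+1).
Proof.
move=> E ht [p0 so [b1 b2] li an] ct e20 e21 e7 cl sl; eapply ter_le.
have gM := gval_le cl ltac:(lia).
have cM : `|(u.+1%:Z * cost q l)%R|%N <= M.
  have al := canon_all av_range cl.
  apply: leq_trans (scaled_cost_bound av_range (ltnSn u) q_bound M_pos MB al) _.
  apply: leq_trans (leq_trans (leq_addr _ _) MK); rewrite leq_mul2l; apply/orP;
    right; lia.
have cM' : `|cost q l|%N <= M by rewrite abszM in cM; apply: leq_trans cM;
  rewrite leq_pmull.
have hu : head 0 l < u.+1.
  by case: (l) (canon_all av_range cl) => // w l' /andP[/av_range/andP[]].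
have hc : head 0 l <= c by rewrite -sl; case: (l) => //= w l'; apply: leq_addr.
have hg : gval l = (u.+1%:Z * cost q l + (head 0%N l)%:Z)%R by [].
(* The head lies in [[0, u]], so the rounded quotient is the cost even when this is negative. *)
apply: (@ter_op _ (cost q l)); [|by lia|].
  by clean_regs; rewrite (env5 E) hg mulrC divzMDl // divz_small ?addr0 //; lia.
op (u.+1%:Z * cost q l)%R; op (Posz (head 0 l)); wr c.
op (- cost q l)%R; wr c; wr c; op (Posz (c - head 0 l)); rd (c - head 0 l).
(* Register 25 becomes the link of [l]. At target 0 an arbitrary word may be read from bank 9, but
   nothing is claimed for the link of [[::]]. *)
apply: (@ter_seq _ _ _ _ _ _
  (fun s1 => l <> [::] -> reg s1 25 = Posz (sumn (others l)))).
  have key w l' : l = w :: l' -> [/\ c - head 0 l = sumn l', 0 < w,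
      cell s 8 (c - head 0 l) = Posz (head 0 l') &
      l' <> [::] -> cell s 9 (c - head 0 l) = Posz (sumn (others l'))].
    move=> e; have cl' : canon l' by move: cl; rewrite e; case.
    have wl : w \in l by rewrite e inE eqxx.
    have w0 : 0 < w by have /av_range := allP (canon_all av_range cl) w wl; lia.
    have e' : c - head 0 l = sumn l' by rewrite -sl e /=; lia.
    by rewrite e'; have [|? ?] := li l' cl'; [rewrite -sl e /=; lia | split].
  apply: ter_if; cbn [eval_test]; lookup => cmp.
    rd (c - head 0 l); apply: ter_done; lookup.
    move: cmp; case el: (l) => [|w l'] // cmp _; rewrite -el in cmp *.
    have [e' w0 e8 e9] := key _ _ el.
    move: cmp; rewrite ifF; last by move: hc; rewrite el /=; lia.
    rewrite e8 => /eqP[] hw; rewrite e9; last first.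
      (* An empty tail has the default head 0, which differs from the positive [w]. *)
      by move=> z; move: w0; rewrite -[w]/(head 0 (w :: l')) -el -hw z.
    have := cl; rewrite el => /others_cons ->.
    by rewrite hw el /= eqxx.
  apply: ter_skip; lookup; move: cmp; case el: (l) => [|w l'] // cmp _;
    rewrite -el in cmp *.
  have [e' w0 e8 e9] := key _ _ el.
  move: cmp; rewrite ifF; last by move: hc; rewrite el /=; lia.
  rewrite e8 e'; have := cl; rewrite el => /others_cons -> hw; rewrite ifF //.
  by apply: contraNF hw => /eqP ->.
move=> s1 F1 h25; keep_env F1 => E1.
have r20 : reg s1 20 = Posz c by rewrite F1.1 //; lookup.
wr c; op (Posz c).
have r21 : reg s1 21 = gval l by rewrite F1.1 //; lookup.
have c8 d : cell s1 8 d = if d == c then Posz (head 0 l) else cell s 8 d.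
  by rewrite F1.2 //; lookup.
have c9 d : cell s1 9 d = cell s 9 d by rewrite F1.2 //; lookup.
have c7 d : cell s1 7 d = cell s 7 d by rewrite F1.2 //; lookup.
have c3 d : cell s1 3 d = if d == c then 1%R else cell s 3 d.
  by rewrite F1.2 //; lookup; use_env.
have c2 d : cell s1 2 d = if d == c then (- cost q l)%R else cell s 2 d.
  by rewrite F1.2 //; lookup.
pose s1' := set_reg (set_cell s1 9 c (reg s1 25)) 27 (Posz c).
have li' : linked s1' c.+1.
  move=> l1 cl1 sl1; rewrite /s1'; lookup; rewrite c8 c9.
  have [e|ne] := eqVneq (sumn l1) c; last by apply: li => //; lia.
  have -> : l1 = l by apply: (canon_unique av_range cl1 cl); rewrite e.
  by split=> // /h25 ->.
apply: ter_seq.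
  apply: (@push_chain_spec s1' l c) => //.
  - by repeat solve_env.
  - by move=> w wB; rewrite /s1'; lookup; rewrite F1.2 //; lookup; apply: ht.
  - by move=> d dt; rewrite /s1'; lookup; rewrite c7; apply: so.
move=> s2 F2 [so2 le2 eq2 pu2]; apply: ter_done; split=> //.
- by rewrite eq2 // /s1'; lookup; rewrite c7.
- split.
    move=> d l1 dB cl1 sl1 d0; apply: le_trans (le2 d) _; rewrite /s1'; lookup;
      rewrite c7.
    exact: b1 cl1 sl1 d0.
  move=> l1 w cl1 sl1 wl1; have [e|ne] := eqVneq (sumn l1) c.
    have el : l1 = l by apply: (canon_unique av_range cl1 cl); rewrite e.
    by rewrite e el; apply: pu2; rewrite -el.
  apply: le_trans (le2 _) _; rewrite /s1'; lookup; rewrite c7.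
  by apply: b2 => //; lia.
- by move=> l1 cl1 sl1; rewrite !F2.2 //; apply: li'.
- move=> d dc; rewrite /answered !F2.2 // /s1'; lookup; rewrite c3 c2.
  have [->|ne] := eqVneq d c; last by apply: an; lia.
  split=> [l1 cl1 sl1|h].
    by have -> : l1 = l by apply: (canon_unique av_range cl1 cl); rewrite sl1.
  by case: (h l (canon_all av_range cl) sl).
lia.
Qed.

Lemma main_loop_spec s : env s -> weight_table s -> progress 0 s ->
  ter main_loop s (t.+1 * (N * 11 + 25) + 3) (progress t.+1).
Proof.
move=> E ht p0; eapply ter_le.
apply: ter_const; first by lia.
pose I c s' := reg s' 20 = Posz c /\ progress c s'.
apply: ter_seq; first apply: (@ter_while W I _ _ _ _ t.+1).
- by move=> s' F [e _]; keep_env F => E'; cbn [eval_test]; rewrite e (env14 E'); lia.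
- move=> c s' ct F [e p]; keep_env F => E'.
  split; first by cbn [eval_test]; rewrite e (env14 E'); lia.
  have ht' : weight_table s' by move=> w wB; rewrite F.2 //; apply: ht.
  have ct' : c <= t by [].
  rd c; apply: (@ter_seq _ _ _ _ _ _ (progress c.+1)).
    have [[l [cl sl e7]]|[h e7]] := progress_value p ct'; rewrite e7.
    + have gM := gval_le cl ltac:(lia).
      apply: ter_if; cbn [eval_test]; lookup; rewrite (env9 E') => cmp; last by lia.
      by apply: (@settle_spec c _ l) => //; repeat solve_env.
    + apply: ter_if; cbn [eval_test]; lookup; rewrite (env9 E') => cmp; first by lia.
      apply: (@ter_le _ _ _ 2); last by lia.
      wr c; apply: ter_done.
      (* No canonical list has sum [c], so the new instances of the invariants are vacuous. *)
      have [c0' so [b1 b2] li an] := p; split=> //.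
      * split=> // l w cl sl wl; apply: b2 => //.
        have := h _ (canon_all av_range cl); lia.
      * move=> l cl sl; apply: li => //; have := h _ (canon_all av_range cl); lia.
      * move=> d dc; rewrite /answered; lookup; use_env.
        have [->|ne] := eqVneq d c; last by apply: an; lia.
        by split=> // l cl sl; case: (h _ (canon_all av_range cl) sl).
  move=> s1 F1 p1; keep_env F1 => E1.
  have r20 : reg s1 20 = Posz c by rewrite F1.1 //; lookup.
  op (Posz c.+1); apply: ter_done; split; first by sv.
  exact: p1.
- by split.
by move=> s1 _ [_ h]; apply: ter_done.
lia.
Qed.

End Programs.

(** * The given convolution program as a subroutine *)

Section Convolution.

Variables (T : nat -> nat) (c0 : cmd) (e0 : nat).
Hypothesis c0_solves : forall (x : instance minplus_convolution) (W : nat) (s : state),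
  valid x -> magnitude x ^ e0 <= W -> fits W s -> encodes x s ->
  exists (k : nat) (s' : state),
    [/\ exec W c0 s k s', k <= T (conv_len x) & answers x s'].

(* On zero inputs, started with ones in the output bank, all [2 u - 1] output
   cells must be overwritten. *)
Lemma conv_time_ge u : 0 < u -> u <= T u.
Proof.
move=> u0;
  pose x : instance minplus_convolution :=
    ConvInstance (fun _ : 'I_u => 0%R) (fun _ => 0%R).
pose s := State (fun r => if r == 0 then Posz u else 0%R)
  (fun b _ => if b == 2 then 1%R else 0%R).
have [|||k [s' [ex kT ans]]] := @c0_solves x (maxn (maxn u 1) (magnitude x ^ e0)) s u0.
- by rewrite leq_max leqnn orbT.
- by split=> [r|b i] /=; case: eqP => _; rewrite !leq_max ?leqnn ?orbT.
- by [].
apply: leq_trans kT.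
have inj : injective (fun i : 'I_(u + u).-1 => nat_of_ord i) by exact: val_inj.
have := exec_changes 2 inj ex; rewrite (_ : #|_| = (u + u).-1); first by lia.
rewrite -[RHS]card_ord; apply: eq_card => i; rewrite !inE /=.
have [[j [k' [_ e]]] _] := ans i.
by have -> : cell s' 2 i = 0%R by rewrite e addr0.
Qed.

(** Registers and banks from 50 on, seen as a state of their own, encode a convolution instance of
    magnitude at most [u + 8 * M + 2]; [exec_shift] transfers its run. *)
Lemma conv_program_spec W u M s : 0 < u -> (u + 8 * M + 2) ^ e0 <= W ->
  reg s 50 = Posz u ->
  (forall i, i < u -> `|cell s 50 i|%N <= 4 * M /\ `|cell s 51 i|%N <= 4 * M) ->
  terminates W (shift 50 c0) s (T u) (fun s' => forall k, k < (u + u).-1 ->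
    (exists i j, [/\ i < u, j < u, i + j = k &
       cell s' 52 k = (cell s 50 i + cell s 51 j)%R]) /\
    (forall i j, i < u -> j < u -> i + j = k ->
       (cell s' 52 k <= cell s 50 i + cell s 51 j)%R)).
Proof.
move=> u0 hW r50 hb f.
pose x : instance minplus_convolution :=
  ConvInstance (fun i : 'I_u => cell s 50 i) (fun i : 'I_u => cell s 51 i).
have mag : magnitude x <= u + 8 * M + 2.
  have h1 : \max_(i < u) `|cell s 50 i|%N <= 4 * M.
    by apply/bigmax_leqP => i _; exact: (hb i (ltn_ord i)).1.
  have h2 : \max_(i < u) `|cell s 51 i|%N <= 4 * M.
    by apply/bigmax_leqP => i _; exact: (hb i (ltn_ord i)).2.
  rewrite (_ : u + 8 * M + 2 = u + 4 * M + 4 * M + 2); last by lia.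
  exact: leq_add (leq_add (leq_add (leqnn u) h1) h2) (leqnn 2).
have [||||k [s' [ex kT ans]]] := @c0_solves x W (upper 50 s).
- exact: u0.
- apply: leq_trans hW; have [->|ep] := posnP e0; by rewrite ?expn0 ?leq_exp2r.
- exact: fits_upper.
- by split.
have [z exz [_ cz]] := exec_shift ex (conj (frefl _) (fun _ _ => erefl)).
exists k, z; split=> // i iu.
have [[j [k' [jk e]]] h] := ans (Ordinal iu).
have ez : cell z 52 i = cell s' 2 i by rewrite -cz.
split.
  by exists j, k'; split=> //; rewrite ez.
by move=> j1 j2 h1 h2 e12; rewrite ez; apply: (h (Ordinal h1) (Ordinal h2)).
Qed.

End Convolution.

(** * Computing the constants and the weight table *)

Definition count_blocks :=
  Const 6 4;; Const 20 1;; Const 21 2;;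
  While (TLe 20 1) (Op OAdd 20 20 20;; Op OAdd 6 6 21;; Skip);; Skip.

Definition bound_profits :=
  Const 13 1;; Const 20 0;;
  While (TLt 20 0)
    (Read 21 1 20;; If (TLt 13 21) (Op OAdd 13 21 3;; Skip) Skip;;
     Op OSub 21 3 21;; If (TLt 13 21) (Op OAdd 13 21 3;; Skip) Skip;;
     Op OAdd 20 20 4;; Skip);;
  Skip.

Definition constants :=
  Op OMul 7 6 1;; Op OAdd 8 7 7;; Op OAdd 11 1 1;; Op OSub 11 11 4;;
  Op OAdd 12 2 1;; Op OAdd 12 12 4;; Op OAdd 14 2 4;; Op OMul 20 13 5;;
  Op OAdd 21 7 12;; Op OMul 20 20 21;; Op OAdd 20 20 20;; Op OAdd 9 20 20;;
  Op OAdd 10 9 9;; Skip.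

Definition fill_table :=
  Const 20 0;;
  While (TLt 20 0)
    (Read 21 0 20;; Read 22 1 20;; Op OMul 22 22 5;; Op OSub 22 3 22;;
     Read 23 4 21;; If (TLt 22 23) (Write 4 21 22;; Skip) Skip;;
     Op OAdd 20 20 4;; Skip);;
  Skip.

Definition setup :=
  Const 3 0;; Const 4 1;; Op OAdd 5 1 4;; count_blocks;; bound_profits;;
  constants;; Const 20 0;; fill 4 7;; fill_table;; Skip.

Ltac sv := clean_regs; try done; lia.
Ltac op v := apply: (@ter_op _ v); [by sv | by lia | ].
Ltac rd i := apply: (@ter_read _ i); [by sv | ].
Ltac wr i := apply: (@ter_write _ i); [by sv | ].

Section Setup.

Variables (W n u t : nat) (wt : 'I_n -> nat) (pf : 'I_n -> int).
Hypothesis u_pos : 0 < u.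
Hypothesis wt_range : forall i, 0 < wt i <= u.

Let J := (trunc_log 2 u).+1.

(** Doubling from 1 exceeds [u] after exactly [J] rounds, each of which adds 2 to the initial 4. *)
Lemma count_blocks_spec s : reg s 1 = Posz u -> 2 * u + 2 * J + 4 <= W ->
  terminates W count_blocks s (J * 4 + 5) (fun s' => reg s' 6 = Posz (J.*2 + 4)).
Proof.
move=> r1 hW; eapply ter_le.
apply: ter_const; first by lia.
apply: ter_const; first by lia.
apply: ter_const; first by lia.
pose I j s' := reg s' 20 = Posz (2 ^ j) /\ reg s' 6 = Posz (j.*2 + 4).
have uJ : u < 2 ^ J by apply: trunc_log_ltn.
apply: ter_seq; first apply: (@ter_while W I _ _ _ _ J).
- move=> s' F [e1 e2]; have r1' : reg s' 1 = Posz u by rewrite F.1 //; sv.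
  by cbn [eval_test]; rewrite e1 r1'; lia.
- move=> j s' jJ F [e1 e2]; have r1' : reg s' 1 = Posz u by rewrite F.1 //; sv.
  have r21 : reg s' 21 = Posz 2 by rewrite F.1 //; sv.
  have le : 2 ^ j <= u.
    apply: (@leq_trans (2 ^ trunc_log 2 u)); last exact: trunc_logP.
    by rewrite leq_exp2l.
  split; first by cbn [eval_test]; rewrite e1 r1'; lia.
  have ej : 2 ^ j.+1 = 2 ^ j + 2 ^ j by rewrite expnS mul2n addnn.
  op (Posz (2 ^ j.+1)); op (Posz (j.+1.*2 + 4)); apply: ter_done.
  by split; lookup.
- by split; lookup.
by move=> s1 _ [_ h]; apply: ter_done.
lia.
Qed.

(** The maximum starts from 1 to be positive even if all profits vanish, hence the bound [P.+1].
    Testing both the profit and its negative yields the absolute value. *)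
Lemma bound_profits_spec s P : reg s 0 = Posz n -> reg s 3 = Posz 0 ->
  reg s 4 = Posz 1 -> (forall i : 'I_n, cell s 1 i = pf i) ->
  (forall i, `|pf i|%N <= P) -> n + P + 1 <= W ->
  terminates W bound_profits s (n * 12 + 4) (fun s' => exists pm,
    [/\ reg s' 13 = Posz pm, 0 < pm <= P.+1 & forall i, `|pf i|%N <= pm]).
Proof.
move=> r0 r3 r4 c1 hP hW; eapply ter_le.
apply: ter_const; first by lia.
apply: ter_const; first by lia.
pose I j s' := reg s' 20 = Posz j /\ exists pm,
    [/\ reg s' 13 = Posz pm, 0 < pm <= P.+1 &
      forall i : 'I_n, i < j -> `|pf i|%N <= pm].
apply: ter_seq; first apply: (@ter_while W I 11 _ _ _ n).
- move=> s' F [e1 _]; have r0' : reg s' 0 = Posz n by rewrite F.1 //; sv.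
  by cbn [eval_test]; rewrite e1 r0'; lia.
- move=> j s' jn F [e1 [pm [e2 pmr h]]].
  have r0' : reg s' 0 = Posz n by rewrite F.1 //; sv.
  have r3' : reg s' 3 = Posz 0 by rewrite F.1 //; sv.
  have r4' : reg s' 4 = Posz 1 by rewrite F.1 //; sv.
  split; first by cbn [eval_test]; rewrite e1 r0'; lia.
  have cj : cell s' 1 j = pf (Ordinal jn) by rewrite F.2 //; lookup; rewrite -c1.
  have := hP (Ordinal jn); set p := pf (Ordinal jn) in cj * => hp.
  have last pm' s1 : reg s1 20 = Posz j.+1 -> reg s1 13 = Posz pm' ->
      pm <= pm' <= P.+1 -> `|p|%N <= pm' -> I j.+1 s1.
    move=> k1 k2 k3 k4; split=> //; exists pm'; split=> //; first by lia.
    move=> i; rewrite ltnS leq_eqVlt => /orP[/eqP ij|ij].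
      by have -> : i = Ordinal jn by apply: val_inj.
    by apply: leq_trans (h i ij) _; lia.
  rd j; rewrite cj; apply: ter_if_seq; cbn [eval_test]; lookup; rewrite e2 => cmp1.
  + apply: ter_seqA; op (Posz `|p|%N); apply: ter_skip_seq; op (- p)%R.
    apply: ter_if_seq; cbn [eval_test]; lookup => cmp2; first by lia.
    apply: ter_skip_seq; op (Posz j.+1); apply: ter_skip.
    by apply: (last `|p|%N); lookup => //; lia.
  + apply: ter_skip_seq; op (- p)%R.
    apply: ter_if_seq; cbn [eval_test]; lookup; rewrite e2 => cmp2.
      apply: ter_seqA; op (Posz `|p|%N); apply: ter_skip_seq; op (Posz j.+1).
      by apply: ter_skip; apply: (last `|p|%N); lookup => //; lia.
    apply: ter_skip_seq; op (Posz j.+1); apply: ter_skip.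
    by apply: (last pm); lookup => //; lia.
- by split; [lookup | exists 1; split; lookup => //; lia].
move=> s1 _ [_ [pm [h1 h2 h3]]]; apply: ter_done; exists pm; split=> // i.
exact: h3.
lia.
Qed.

(** This is the [M] of the program: [pm * u.+1] bounds the scaled cost of one weight, a list has at
    most as many entries as its sum, and the factor 2 leaves room for the recorded weight. *)
Definition word_bound N pm := 2 * (pm * u.+1 * (N * u + (t + u).+1)).

Lemma constants_spec s N pm : reg s 0 = Posz n -> reg s 1 = Posz u ->
  reg s 2 = Posz t -> reg s 3 = Posz 0 -> reg s 4 = Posz 1 -> reg s 5 = Posz u.+1 ->
  reg s 6 = Posz N -> reg s 13 = Posz pm -> 0 < pm ->
  8 * word_bound N pm + n <= W ->
  terminates W constants s 14 (env n u t N (N * u) pm (word_bound N pm)).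
Proof.
move=> r0 r1 r2 r3 r4 r5 r6 r13 pm0; rewrite /word_bound => hW.
set D := N * u + (t + u).+1 in hW *; set k := pm * u.+1 in hW *.
have k0 : 0 < k by rewrite muln_gt0 pm0.
have kD1 : D <= k * D by rewrite leq_pmull.
have kD2 : k <= k * D by rewrite leq_pmulr // /D; lia.
have eD : D = N * u + (t + u).+1 by [].
op (Posz (N * u)); op (Posz (N * u + N * u)); op (Posz (u + u)).
op (Posz (u + u).-1); op (Posz (t + u)); op (Posz (t + u).+1); op (Posz t.+1).
op (Posz k); op (Posz D); op (Posz (k * D)); op (Posz (k * D + k * D)).
op (Posz (2 * (2 * (k * D)))); op (Posz (4 * (2 * (k * D)))).
by apply: ter_done; split; lookup.
Qed.

Variables (av : pred nat) (q : nat -> int).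
Hypothesis av_wt : forall i, av (wt i).
Hypothesis q_le : forall i, (q (wt i) <= - pf i)%R.
Hypothesis q_attained : forall w, av w -> exists2 i, wt i = w & q w = (- pf i)%R.

(** Items may share a weight, and the table keeps the least scaled cost. Each entry comes from an
    item or is [inf], and is at most the scaled cost of every item read; the two conditions on [q]
    then determine it. *)
Lemma fill_table_spec s N pm M : env n u t N (N * u) pm M s -> u < N * u ->
  (forall i, `|pf i|%N * u.+1 <= M) -> 4 * M + n + u <= W ->
  (forall i : 'I_n, cell s 0 i = Posz (wt i)) ->
  (forall i : 'I_n, cell s 1 i = pf i) ->
  (forall w, w < N * u -> cell s 4 w = Posz (4 * M)) ->
  terminates W fill_table s (n * 12 + 3) (weight_table u (N * u) M av q).
Proof.
move=> [r0 r1 r2 r3 r4 r5 _ _ _ _ _ _ _ _ _] uN hM hW c0 c1 c4; eapply ter_le.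
apply: ter_const; first by lia.
pose I j s' := [/\ reg s' 20 = Posz j,
  forall w, w < N * u -> cell s' 4 w = Posz (4 * M) \/
    exists2 i : 'I_n, wt i = w & cell s' 4 w = (u.+1%:Z * - pf i)%R &
  forall i : 'I_n, i < j -> (cell s' 4 (wt i) <= u.+1%:Z * - pf i)%R].
apply: ter_seq; first apply: (@ter_while W I 10 _ _ _ n).
- move=> s' F [e1 _ _]; have r0' : reg s' 0 = Posz n by rewrite F.1 //; sv.
  by cbn [eval_test]; rewrite e1 r0'; lia.
- move=> j s' jn F [e1 h1 h2].
  have r0' : reg s' 0 = Posz n by rewrite F.1 //; sv.
  have r3' : reg s' 3 = Posz 0 by rewrite F.1 //; sv.
  have r4' : reg s' 4 = Posz 1 by rewrite F.1 //; sv.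
  have r5' : reg s' 5 = Posz u.+1 by rewrite F.1 //; sv.
  split; first by cbn [eval_test]; rewrite e1 r0'; lia.
  set o := Ordinal jn.
  have d0 : cell s' 0 j = Posz (wt o) by rewrite F.2 //; lookup; rewrite -c0.
  have d1 : cell s' 1 j = pf o by rewrite F.2 //; lookup; rewrite -c1.
  have hMo := hM o; rewrite -{1}[u.+1]/`|Posz u.+1|%N -abszM in hMo.
  have hw := wt_range o.
  rd j; rewrite d0; rd j; lookup; rewrite d1.
  op (pf o * u.+1%:Z)%R; op (u.+1%:Z * - pf o)%R; rd (wt o).
  apply: ter_if_seq; cbn [eval_test]; lookup => cmp.
  + apply: ter_seqA; wr (wt o); apply: ter_skip_seq; op (Posz j.+1); apply: ter_done.
    split; first by sv.
      by move=> w wN; lookup; case: eqP => [->|_]; [right; exists o | apply: h1].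
    move=> i ij; lookup; case: eqP => [e|ne].
      have := q_le o; have [lt|ge] := ltnP i j.
        by move=> _; apply: le_trans (h2 i lt); rewrite e; exact: ltW.
      by have -> : i = o by apply: val_inj => /=; lia.
    have [lt|ge] := ltnP i j; first exact: h2.
    by case: ne; have -> : i = o by apply: val_inj => /=; lia.
  + apply: ter_skip_seq; op (Posz j.+1); apply: ter_skip.
    split; [by sv | exact: h1 |].
    move=> i ij; lookup; have [lt|ge] := ltnP i j; first exact: h2.
    have -> : i = o by apply: val_inj => /=; lia.
    by rewrite leNgt.
- by split=> // w wN; left; lookup; apply: c4.
move=> s1 _ [_ h1 h2]; apply: ter_done => w wN.
have tbl i : wt i = w -> (cell s1 4 w <= u.+1%:Z * - pf i)%R.
  by move=> <-; apply: h2.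
case: ifP => avw.
  have [i iw qi] := q_attained avw.
  case: (h1 w wN) => [e|[i' iw' e]].
    have := tbl i iw; have := hM i; rewrite -{1}[u.+1]/`|Posz u.+1|%N -abszM e.
    by have := wt_range i; lia.
  apply/eqP; rewrite eq_le {1}qi tbl //= e ler_wpM2l //.
  by rewrite -iw' q_le.
case: (h1 w wN) => // -[i iw _]; by rewrite -iw av_wt in avw.
lia.
Qed.

Lemma setup_spec s P : reg s 0 = Posz n -> reg s 1 = Posz u -> reg s 2 = Posz t ->
  (forall i : 'I_n, cell s 0 i = Posz (wt i)) -> (forall i : 'I_n, cell s 1 i = pf i) ->
  (forall i, `|pf i|%N <= P) -> 8 * word_bound (J.*2 + 4) P.+1 + n <= W ->
  terminates W setup s (J * 4 + n * 24 + (J.*2 + 4) * u * 4 + 40) (fun s' => exists pm,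
    [/\ 0 < pm <= P.+1, forall i, `|pf i|%N <= pm,
      env n u t (J.*2 + 4) ((J.*2 + 4) * u) pm (word_bound (J.*2 + 4) pm) s' &
      weight_table u ((J.*2 + 4) * u) (word_bound (J.*2 + 4) pm) av q s']).
Proof.
move=> r0 r1 r2 c0 c1 hP hW; eapply ter_le.
set N := J.*2 + 4 in hW *.
have eN : N = J.*2 + 4 by [].
(* The word length is known to suffice for [P.+1], while the program works with the bound [pm] that
   it has computed. *)
have mono pm : pm <= P.+1 -> word_bound N pm <= word_bound N P.+1.
  by move=> h; rewrite /word_bound leq_mul2l /= leq_mul2r leq_mul2r h !orbT.
have lower pm : 0 < pm -> pm * u.+1 + N * u + (t + u).+1 <= word_bound N pm.
  move=> pm0; rewrite /word_bound.
  set D := N * u + (t + u).+1; set k := pm * u.+1.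
  have k0 : 0 < k by rewrite muln_gt0 pm0.
  have kD1 : D <= k * D by rewrite leq_pmull.
  have kD2 : k <= k * D by rewrite leq_pmulr // /D; lia.
  by rewrite -addnA -/D; lia.
have low := lower P.+1 isT.
have P1 : P.+1 <= P.+1 * u.+1 by rewrite leq_pmulr.
have NN : N <= N * u by rewrite leq_pmulr.
have uN : u < N * u by rewrite -{1}[u]mul1n ltn_pmul2r // /N; lia.
apply: ter_const; first by lia.
apply: ter_const; first by lia.
op (Posz u.+1).
apply: ter_seq.
  by apply: count_blocks_spec; [sv | lia].
move=> s1 F1 h6.
have bnk b i : b \in [:: 0; 1] -> cell s1 b i = cell s b i.
  by rewrite !inE => /orP[/eqP|/eqP] ->; rewrite F1.2.
apply: ter_seq.
  apply: (@bound_profits_spec _ P) => //; try by rewrite F1.1 //; sv.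
  - by move=> i; rewrite bnk.
  - by lia.
move=> s2 F2 [pm [h13 /andP[pm0 pmP] hpm]].
have low' := lower pm pm0; have mono' := mono pm pmP.
apply: ter_seq.
  apply: (@constants_spec _ N pm) => //; try by rewrite F2.1 // F1.1 //; sv.
  - by lia.
move=> s3 F3 E3; apply: ter_const; first by lia.
have Wb : 8 * word_bound N pm + n <= W by lia.
apply: ter_seq.
  apply: (@fill_spec W n u t N (N * u) pm (word_bound N pm) u_pos _ erefl _ Wb
    _ 4 0 7 (N * u)) => //; try lia.
  - by apply: env_set_reg E3.
  - by lookup; case: E3.
move=> s4 F4 [h4 _].
have E4 : env n u t N (N * u) pm (word_bound N pm) s4.
  by apply: (env_frame _ F4) => //; apply: env_set_reg E3.
have bnk' b i : b \in [:: 0; 1] -> cell s4 b i = cell s b i.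
  move=> hb; rewrite -bnk //; move: hb; rewrite !inE => /orP[/eqP|/eqP] ->;
  by rewrite F4.2 //; lookup; rewrite F3.2 // F2.2.
apply: ter_seq.
  apply: (fill_table_spec E4) => //.
  - move=> i; have : `|pf i|%N * u.+1 <= pm * u.+1 by rewrite leq_mul2r hpm orbT.
    by lia.
  - by lia.
  - by move=> i; rewrite bnk'.
  - by move=> i; rewrite bnk'.
move=> s5 F5 h5; apply: ter_done; exists pm; split=> //; first by rewrite pm0.
by apply: (env_frame _ F5).
lia.
Qed.

End Setup.

(** * From lists of weights to multiplicity vectors *)

Section Vectors.

Variables (n : nat) (wt : 'I_n -> nat) (pf : 'I_n -> int).

Definition available (w : nat) : bool := [exists i, wt i == w].

Lemma ex_best_cost : exists q : nat -> int,
  (forall i, q (wt i) <= - pf i)%R /\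
  (forall w, available w -> exists2 i, wt i = w & q w = (- pf i)%R).
Proof.
pose best w i0 := [arg max_(i > i0 | wt i == w) pf i]%O.
exists (fun w => if [pick i | wt i == w] is Some i0 then (- pf (best w i0))%R else 0%R).
split=> [i|w /existsP[i iw]].
  case: pickP => [i0 e0|/(_ i)]; last by rewrite eqxx.
  by rewrite /best; case: Order.TotalTheory.arg_maxP => //= j _ /(_ i (eqxx _));
    rewrite lerN2.
case: pickP => [i0 e0|/(_ i)]; last by rewrite iw.
by rewrite /best; case: Order.TotalTheory.arg_maxP => //= j /eqP jw _; exists j.
Qed.

Variable q : nat -> int.
Hypothesis q_le : forall i, (q (wt i) <= - pf i)%R.
Hypothesis q_attained : forall w, available w -> exists2 i, wt i = w & q w = (- pf i)%R.

Lemma vector_of_list l : all available l -> exists m : 'I_n -> nat,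
  \sum_i wt i * m i = sumn l /\ (\sum_i pf i * (m i)%:Z = - cost q l)%R.
Proof.
elim: l => [|w l IH] /=.
  by exists (fun=> 0); rewrite cost_nil !big1 // => i _; rewrite ?muln0 ?mulr0.
move=> /andP[/q_attained[i iw qi] /IH[m [s c]]].
exists (fun j => (j == i) + m j); split.
  under eq_bigr do rewrite mulnDr.
  rewrite big_split /= s (bigD1 i) //= eqxx muln1 big1 ?addn0 ?iw // => j ne.
  by rewrite (negbTE ne) muln0.
under eq_bigr do rewrite PoszD mulrDr.
rewrite big_split /= c (bigD1 i) //= eqxx mulr1 big1 ?addr0.
  by rewrite cost_cons qi opprD opprK.
by move=> j ne; rewrite (negbTE ne) mulr0.
Qed.

(** Only an inequality, unlike in [vector_of_list]: the vector may use items that are not the best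
    of their weight. *)
Lemma list_of_vector (m : 'I_n -> nat) : exists l, [/\ all available l,
  sumn l = \sum_i wt i * m i & (cost q l <= - \sum_i pf i * (m i)%:Z)%R].
Proof.
elim: (index_enum _) => [|i r [l [a s c]]].
  by exists [::]; rewrite !big_nil cost_nil oppr0.
exists (nseq (m i) (wt i) ++ l); rewrite !big_cons; split.
- rewrite all_cat a all_nseq andbT; apply/orP; right; apply/existsP; exists i;
    exact: eqxx.
- by rewrite sumn_cat sumn_nseq s.
- rewrite cost_cat opprD lerD //.
  elim: (m i) => [|k IH] /=; first by rewrite cost_nil mulr0 oppr0.
  by rewrite cost_cons -add1n PoszD mulrDr mulr1 opprD lerD.
Qed.

End Vectors.

(** * Word length and running time *)

Lemma blocks_le_lg u : 0 < u -> (trunc_log 2 u).+1.*2 + 4 <= 8 * lg u.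
Proof. by rewrite /lg; lia. Qed.

(** The word bound is at most [18 * g ^ 4], and [g >= 5] gives [g ^ 4 >= 625], so another factor
    [g ^ 4] absorbs the constants. *)
Lemma word_bound_le n u t P g : 0 < n -> 0 < u -> 0 < t -> n + u + t + P + 2 <= g ->
  16 * word_bound u t ((trunc_log 2 u).+1.*2 + 4) P.+1 + n + u + 2 <= g ^ 8.
Proof.
move=> n0 u0 t0 hg.
set N := _.*2 + 4.
have Nu : N <= 8 * g.
  have : trunc_log 2 u < u.
    by apply: (@leq_trans (2 ^ trunc_log 2 u)); [exact: ltn_expl | exact: trunc_logP].
  by rewrite /N; lia.
have g5 : 5 <= g by lia.
have e1 : N * u <= 8 * g * g by apply: leq_mul => //; lia.
have e2 : P.+1 * u.+1 <= g * g by apply: leq_mul; lia.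
have e3 : N * u + (t + u).+1 <= 9 * g * g by nia.
have e4 : P.+1 * u.+1 * (N * u + (t + u).+1) <= (g * g) * (9 * g * g) by apply: leq_mul.
have e5 : word_bound u t N P.+1 <= 18 * (g * g * (g * g)) by rewrite /word_bound; lia.
have -> : g ^ 8 = (g * g * (g * g)) * (g * g * (g * g)).
  by rewrite -[8]/(2 * 2 * 2)%N !expnM !mulnn.
set h := g * g * (g * g) in e5 *.
have gg : 25 <= g * g by apply: (@leq_mul 5 5).
have h625 : 25 * 25 <= h by apply: (@leq_mul 25 25).
have gh : g <= h by rewrite /h -mulnA leq_pmulr; lia.
have : 625 * h <= h * h by rewrite leq_mul2r; apply/orP; right; lia.
lia.
Qed.

(** The [N] squarings with [N * N] convolutions each give [Tu * L ^ 3]; [u <= Tu] absorbs the work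
    linear in [u]. The leading constant is [9 * 2468], and rounding it up to [9 * 3000] pays for the
    lower terms. *)
Lemma time_le (n u t J N Tu L : nat) : 0 < u -> 0 < t -> 0 < L -> u <= Tu ->
  J * 4 <= L * 8 -> N <= 8 * L ->
  (J * 4 + n * 24 + N * u * 4 + 40) +
  (((N + 1) * (N * (N * (Tu + 32 * u + 3) + 5) + 14 * (N * u) + 12) +
    15 * (N * u) + 4 * (t + u) + 40) +
   (t.+1 * (N * 11 + 25) + 3)) <=
  9 * 3000 * (Tu * L ^ 3 + t * L ^ 2 + (n - u)).
Proof.
move=> u0 t0 L0 uT JL NL.
have Nu : N * u <= 8 * (L * Tu) by rewrite mulnA; apply: leq_mul.
set X := L * Tu in Nu *.
have X0 : 0 < X by rewrite muln_gt0 L0; lia.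
have TX : Tu <= X by rewrite leq_pmull.
have LX : L <= X by rewrite leq_pmulr //; lia.
have d1 : N * (Tu + 32 * u + 3) <= 288 * X.
  apply: (@leq_trans (8 * L * (36 * Tu))); first by apply: leq_mul => //; lia.
  by rewrite /X; lia.
have d2 : N * (N * (Tu + 32 * u + 3) + 5) <= 8 * L * (293 * X).
  by apply: leq_mul => //; lia.
set Y := L * X; have XY : X <= Y by rewrite leq_pmull.
have d3 : N * (N * (Tu + 32 * u + 3) + 5) + 14 * (N * u) + 12 <= 2468 * Y.
  by rewrite /Y in XY *; lia.
have d4 : (N + 1) * (N * (N * (Tu + 32 * u + 3) + 5) + 14 * (N * u) + 12) <=
    9 * L * (2468 * Y).
  by apply: leq_mul => //; lia.
have eZ : Tu * L ^ 3 = L * Y by rewrite /Y /X !expnS expn0; lia.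
have YZ : Y <= L * Y by rewrite leq_pmull.
have d5 : t.+1 * (N * 11 + 25) <= 2 * t * (113 * L) by apply: leq_mul; lia.
have d6 : t * L <= t * L ^ 2 by rewrite leq_mul2l expnS leq_pmulr ?orbT // expn_gt0 L0.
have d7 : t <= t * L by rewrite leq_pmulr.
rewrite eZ; lia.
Qed.

Definition knapsack_program c0 := setup;; base c0;; main_loop.

(* The summand [items x - max_weight x] (truncated subtraction) vanishes when
   n <= u; it only pays for reading the surplus items of an instance that lists
   more items than there are possible weights. *)
Theorem theorem15 (T : nat -> nat)
    (hT : @solvable_in minplus_convolution (fun x => T (conv_len x))) :
  exists C : nat,
    @solvable_in all_target_unbounded_knapsack
      (fun x => C * (T (max_weight x) * lg (max_weight x) ^ 3
                     + target x * lg (max_weight x) ^ 2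
                     + (items x - max_weight x))).
Proof.
have [c0 [e0 c0_solves]] := hT; exists (9 * 3000).
(* The words of the program itself need [g ^ 8]; the subroutine needs the power [e0] of a magnitude
   that is again at most [g ^ 8]. *)
exists (knapsack_program c0), (8 * e0.+1) => -[n u t wt pf] W s /= [n0 u0 t0 wt_range].
set P := \max_(i < n) `|pf i|%N; set g := n + u + t + P + 2.
move=> gW fitsW [[r0 r1 r2] c0' c1].
set J := (trunc_log 2 u).+1; set N := J.*2 + 4.
have hP i : `|pf i|%N <= P by apply: (@leq_bigmax _ (fun i => `|pf i|%N)).
have uJ : u < 2 ^ J by apply: trunc_log_ltn.
have big := @word_bound_le n u t P g n0 u0 t0 (leqnn _).
rewrite -/J -/N in big.
have gW1 : g ^ 8 <= W.
  apply: leq_trans gW; rewrite leq_exp2l ?leq_pmulr //; rewrite /g; lia.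
have gW2 : (g ^ 8) ^ e0 <= W.
  apply: leq_trans gW; rewrite -expnM leq_exp2l ?leq_mul2l ?leqnSn ?orbT //;
    rewrite /g; lia.
have [q [q_le q_att]] := ex_best_cost wt pf.
have av_wt i : available wt (wt i) by apply/existsP; exists i.
have av_range w : available wt w -> 0 < w <= u by move=> /existsP[i /eqP <-].
have uT := conv_time_ge c0_solves u0.
have [L0 NL] : 0 < lg u /\ N <= 8 * lg u by split; [rewrite /lg;
  lia | exact: blocks_le_lg].
have JL : J * 4 <= lg u * 8 by rewrite /J /lg; lia.
suff : terminates W (knapsack_program c0) s
    (9 * 3000 * (T u * lg u ^ 3 + t * lg u ^ 2 + (n - u)))
    (fun s' => forall c, 1 <= c <= t ->
      @is_opt (KnapsackInstance u t wt pf) c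
        (if cell s' 3 c == 0%R then None else Some (cell s' 2 c))).
  by move/(_ fitsW) => [k [s' [ex kle ans]]]; exists k, s'; split.
apply: (ter_le _ (time_le n u0 t0 L0 uT JL NL)).
have W_setup : 8 * word_bound u t N P.+1 + n <= W by lia.
apply: ter_seq.
  by apply: (@setup_spec W n u t wt pf u0 wt_range (available wt) q
    av_wt q_le q_att s P).
move=> s1 F1 [pm [pmP hpm E1 tbl]].
have q_bound w : available wt w -> `|(u.+1%:Z * q w)%R|%N <= pm * u.+1.
  by move=> /q_att[i _ ->]; rewrite abszM abszN mulnC leq_mul2r hpm orbT.
set M := word_bound u t N pm in E1 tbl *.
have leM : M <= word_bound u t N P.+1.
  case/andP: pmP => _ h.
  by rewrite /M /word_bound leq_mul2l /= leq_mul2r leq_mul2r h !orbT.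
have k1 : u.+1 <= pm * u.+1 by rewrite leq_pmull //; case/andP: pmP.
have MK : pm * u.+1 * (N * u + (t + u).+1) + u <= M.
  rewrite /M /word_bound mul2n -addnn leq_add2l.
  apply: leq_trans (leq_trans (leqnSn u) k1) _; rewrite leq_pmulr //; lia.
have M_big : N * u + t + u < M.
  apply: leq_trans MK; apply: leq_trans (leq_addr _ _).
  have : N * u + (t + u).+1 <= pm * u.+1 * (N * u + (t + u).+1).
    by rewrite leq_pmull //; lia.
  lia.
have W_big : 8 * M + n <= W by lia.
have N0 : 0 < N by rewrite /N addn4.
have NB : N * u <= 2 ^ N.
  (* Here [2 ^ N = 2 ^ J * 2 ^ J * 2 ^ 4]: one factor [2 ^ J] bounds [u], the others bound [N]. *)
  rewrite {2}/N -addnn !expnD mulnC -mulnA; apply: leq_mul; first exact: ltnW.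
  have : J < 2 ^ J by apply: ltn_expl.
  by rewrite /N -[2 ^ 4]/16; lia.
have hW : (u + 8 * M + 2) ^ e0 <= W.
  apply: leq_trans gW2; have [->|ep] := posnP e0; first by rewrite !expn0.
  by rewrite leq_exp2r //; lia.
apply: ter_seq.
  apply: (@base_spec W n u t N (N * u) pm M u0 N0 erefl M_big W_big c0 (T u)
    (fun s => conv_program_spec c0_solves u0 hW (s := s))
    (available wt) q (pm * u.+1) av_range q_bound MK NB s1 E1 tbl).
move=> s2 F2 [z7 so2 b2].
have E2 : env n u t N (N * u) pm M s2.
  by apply: (env_frame _ F2) => //; rewrite /= !writes_reg_shift.
have tbl2 : weight_table u (N * u) M (available wt) q s2.
  by move=> w wN; rewrite F2.2 ?tbl //= !writes_bank_shift.
apply: (ter_weaken (@main_loop_spec W n u t N (N * u) pm M u0 N0 erefl M_big W_big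
  (available wt) q (pm * u.+1) av_range q_bound MK NB J erefl uJ s2 E2 tbl2 _)) => //.
move=> s3 _ [_ _ _ _ ans] c /andP[c1' ct].
have [yes no] := ans c ct.
have [[l al sl]|none] := classic (exists2 l, all (available wt) l & sumn l = c).
  have [l1 cl1 sl1] := ex_canon q av_range al; rewrite sl in sl1.
  have [-> ->] := yes l1 cl1 sl1; rewrite /=.
  have [al1 opt1] := canon_opt av_range cl1.
  split.
    have [m [hm hc]] := vector_of_list q_att al1.
    by exists m; rewrite /is_solution /value /= hm sl1.
  move=> m hm; have [l2 [al2 sl2 cl2]] := list_of_vector q_le m.
  have := opt1 l2 al2; rewrite sl2 sl1 => /(_ (esym hm)) le.
  by rewrite /value /= lerNr; apply: le_trans le cl2.
rewrite no ?eqxx /=; last by move=> l al sl; apply: none; exists l.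
case=> m hm; apply: none; have [l2 [al2 sl2 _]] := list_of_vector q_le m.
by exists l2 => //; rewrite sl2 -hm.
Qed.
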